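(* Let $f$ be a Stieltjes function $f(z)=\int_{-\infty}^0\frac{g(t)}{t-z}\,dt$, and consider the restarted adaptive Krylov subspace method for computing $f(A)b$ in which the basis of each restart cycle is generated by the truncated Arnoldi process followed by a rank-1 update. (i) If the rank-1 update enforces $b_{m+1}\perp B_m$ in each cycle, then the method is mathematically equivalent to the restarted Arnoldi method for computing $f(A)b$. Hence, if $A$ is Hermitian positive definite, the method converges, i.e. $f^{[k]}\to f(A)b$ as $k\to\infty$, for every restart length $m\ge1$. (ii) If the rank-1 update enforces $b_{m+1}\perp AB_m$ in each cycle, then the method is mathematically equivalent to the restarted harmonic Arnoldi method for computing $f(A)b$. Hence, if $A$ is positive real, the method converges, i.e. $f^{[k]}\to f(A)b$ as $k\to\infty$, for every restart length $m\ge1$. Here the restart length $m=m_k\geq 1$ is whatever the adaptive rule produces in cycle $k$, and ''mathematically equivalent'' means that both methods, run with the same restart lengths, produce the same approximations $f^{[k]}$.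
   Context: Setting. $A\in\mathbb{C}^{N\times N}$, $b\in\mathbb{C}^N$; $A$ is positive real if $\Re(x^*Ax)>0$ for all nonzero $x\in\mathbb{C}^N$. $g$ is a suitable nonpositive function on $(-\infty,0]$. For a matrix $B$, $x\perp B$ means $B^*x=0$. Exact arithmetic is assumed, quadrature errors are neglected, no breakdown occurs (Krylov subspaces $\mathcal{K}_j(A,v)=\mathrm{span}\{v,\dots,A^{j-1}v\}$ have dimension $j$), and the matrix functions involved are assumed to be defined. Arnoldi-like decomposition with starting vector $v$: $AB_m=B_mH_m+b_{m+1}h_{m+1,m}e_m^\top$, where the columns $b_1,\dots,b_m$ of $B_m$ form a (not necessarily orthonormal) basis of $\mathcal{K}_m(A,v)$, $H_m=(h_{i,j})$ is upper Hessenberg, and $v=b_1\beta$. Rank-1 update: writing $b_{m+1}=B_mc+\widetilde b_{m+1}\alpha$ with a normalization scalar $\alpha$, the decomposition becomes $AB_m=B_m\widetilde H_m+\widetilde b_{m+1}\widetilde h_{m+1,m}e_m^\top$ with $\widetilde H_m=H_m+c\,h_{m+1,m}e_m^\top$ and $\widetilde h_{m+1,m}=\alpha h_{m+1,m}$. The choice $c=B_m^\dagger b_{m+1}$ enforces $\widetilde b_{m+1}\perp B_m$; the choice $c=((AB_m)^*B_m)^{-1}(AB_m)^*b_{m+1}$ enforces $\widetilde b_{m+1}\perp AB_m$. After the update the tildes are dropped. Restarting scheme. Cycle $k=0,1,2,\dots$ uses an Arnoldi-like decomposition with matrices $B^{[k]}_{m_k},H^{[k]}_{m_k}$, last vector $b^{[k]}_{m_k+1}$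 and scalar $\beta^{[k]}$; the starting vector is $b$ for $k=0$ and $b^{[k-1]}_{m_{k-1}+1}$ for $k\ge1$. Put $g^{[0]}=g$, $\mathrm{err}^{[0]}=f$, and for $k\ge1$, $g^{[k]}(t)=\gamma^{[k-1]}\beta^{[k-1]}g^{[k-1]}(t)/\phi^{[k-1]}(t)$, $\mathrm{err}^{[k]}(z)=\int_{-\infty}^0\frac{g^{[k]}(t)}{t-z}\,dt$, where $\gamma^{[\ell]}=\prod_{j=1}^{m_\ell}h^{[\ell]}_{j+1,j}$ and $\phi^{[\ell]}(t)=\det(tI-H^{[\ell]}_{m_\ell})$. The approximations are $f^{[0]}=B^{[0]}_{m_0}f(H^{[0]}_{m_0})e_1\beta^{[0]}$ and $f^{[k]}=f^{[k-1]}+B^{[k]}_{m_k}\mathrm{err}^{[k]}(H^{[k]}_{m_k})e_1\beta^{[k]}$. Restarted adaptive method. In each cycle the decomposition is generated by the truncated Arnoldi process with truncation parameter $t\ge0$: $\beta=\|v\|$, $b_1=v/\beta$, and for $j=1,2,\dots$ the vector $Ab_j$ is orthogonalized by modified Gram–Schmidt only against $b_i$, $\max(1,j-t+1)\le i\le j$ (coefficients $h_{i,j}$), and normalized to give $b_{j+1}$, with $h_{j+1,j}$ the norm. The process stops at the first $j$ for which the condition number of the sketched basis $S[b_1,\dots,b_{j+1}]$ exceeds a threshold $\tau$, or at $j=m_{\max}$; then $m=j$. Here $S$ is a (random) sketching matrix, enlarged by additional rows when needed; from the second cycle on $m_{\max}=m_0$. The rank-1 update is then applied. Restarted Arnoldi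 method: the restarting scheme in which $B_m$ and $b_{m+1}$ come from the standard Arnoldi process, so $[B_m\ b_{m+1}]$ has orthonormal columns. Restarted harmonic Arnoldi method: the restarting scheme in which $B_m$ comes from the standard Arnoldi process (orthonormal columns), each cycle uses the harmonic Arnoldi approximation $B_m h\big(((AB_m)^*B_m)^{-1}(AB_m)^*(AB_m)\big)e_1\beta$ (with $h=f$ or $h=\mathrm{err}^{[k]}$), and the next cycle starts from the last vector $b_{m+1}\in\mathcal{K}_{m+1}(A,v)$ satisfying $b_{m+1}\perp AB_m$ (equivalently, from the direction of the harmonic Arnoldi residual). *)

(* Defs.v *)
From HB Require Import structures.
From mathcomp Require Import all_boot all_order all_algebra.
From mathcomp Require Import spectral complex.
From mathcomp Require Import all_classical all_reals all_analysis.

Set Implicit Arguments.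
Unset Strict Implicit.
Unset Printing Implicit Defensive.

Import Order.TTheory GRing.Theory Num.Theory.
Import numFieldNormedType.Exports.

Local Open Scope classical_set_scope.
Local Open Scope ring_scope.
Local Open Scope complex_scope.
Local Open Scope sesquilinear_scope.

Definition vnorm (R : realType) (n : nat) (x : 'cV[R[i]]_n) : R :=
  Num.sqrt (\sum_i Normc.normc (x i 0) ^+ 2).

Definition converges_to (R : realType) (n : nat) (u : nat -> 'cV[R[i]]_n)
    (l : 'cV[R[i]]_n) : Prop :=
  vnorm (u k - l) @[k --> \oo] --> (0 : R).

(* x^* y, conjugate-linear in x *)
Definition cdot (R : realType) (n : nat) (x y : 'cV[R[i]]_n) : R[i] :=
  (x^t* *m y) 0 0.

(* x \perp B *)
Definition orthogonal_to (R : realType) (n m : nat)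
    (B : 'M[R[i]]_(n, m)) (x : 'cV[R[i]]_n) : Prop :=
  B^t* *m x = 0.

Definition positive_real (R : realType) (n : nat) (A : 'M[R[i]]_n) : Prop :=
  forall x : 'cV[R[i]]_n, x != 0 -> 0 < complex.Re (cdot x (A *m x)).

Definition hermitian_posdef (R : realType) (n : nat) (A : 'M[R[i]]_n) : Prop :=
  A \is hermsymmx /\
  forall x : 'cV[R[i]]_n, x != 0 -> 0 < cdot x (A *m x).

(* The primary matrix function phi(H) in the sense of Hermite interpolation:
   phi(H) = p(H) for any polynomial p that matches phi and its complex
   derivatives at every eigenvalue of H, up to the order given by the
   multiplicity of the eigenvalue in the minimal polynomial of H.  Such a p
   always exists and p(H) does not depend on it; the value is meaningful when
   the derivatives occurring here exist. *)
Definition is_matfun (R : realType) (n : nat) (phi : R[i] -> R[i])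
    (H F : 'M[R[i]]_n.+1) : Prop :=
  let C : numFieldType := R[i] in
  exists2 p : {poly R[i]},
    forall (lambda : R[i]) (j : nat), (j < mup lambda (mxminpoly H))%N ->
      (derivn j p).[lambda] = derive1n j (phi : C -> C) lambda
    & F = horner_mx H p.

Definition matfun (R : realType) (n : nat) (phi : R[i] -> R[i])
    (H : 'M[R[i]]_n.+1) : 'M[R[i]]_n.+1 :=
  xget 0 [set F | is_matfun phi H F].

(* z <= 0 in R[i] means that z is real and nonpositive, so the functions
   z |-> \int_{-oo}^0 g(t) / (t - z) dt below are considered on the complement
   of [set z | z <= 0], and a matrix function of such a function is defined
   when no eigenvalue of the matrix lies on the cut. *)
Definition spectrum_off_cut (R : realType) (n : nat) (H : 'M[R[i]]_n) : Prop :=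
  forall lambda : R[i], eigenvalue H lambda -> ~~ (lambda <= 0).

Definition stieltjes (R : realType) (g : R -> R[i]) (z : R[i]) : R[i] :=
  let F := fun t : R => g t / (t%:C - z) in
  Rintegral lebesgue_measure `]-oo, 0%R] (fun t => complex.Re (F t)) +i*
  Rintegral lebesgue_measure `]-oo, 0%R] (fun t => complex.Im (F t)).

(* The integral defining f(z) converges absolutely for all z off the cut *)
Definition stieltjes_density (R : realType) (g : R -> R) : Prop :=
  (forall t : R, t <= 0 -> g t <= 0) /\
  forall z : R[i], ~~ (z <= 0) ->
    let F := fun t : R => (g t)%:C / (t%:C - z) in
    lebesgue_measure.-integrable `]-oo, 0%R] (fun t => (complex.Re (F t))%:E) /\
    lebesgue_measure.-integrable `]-oo, 0%R] (fun t => (complex.Im (F t))%:E).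

Definition stieltjes_fun (R : realType) (g : R -> R) : R[i] -> R[i] :=
  stieltjes (fun t => (g t)%:C).

Definition krylov (R : realType) (n : nat) (A : 'M[R[i]]_n.+1)
    (v : 'cV[R[i]]_n.+1) (j : nat) : 'M[R[i]]_(n.+1, j) :=
  \matrix_(i < n.+1, l < j) (A ^+ l *m v) i 0.

(* The data produced by one cycle with restart length m = prelen.+1:
   basis = B_m, hess = H_m, nextv = b_{m+1}, subdiag = h_{m+1,m}. *)
Record decomp (R : realType) (n : nat) := Decomp {
  prelen : nat;
  basis : 'M[R[i]]_(n.+1, prelen.+1);
  hess : 'M[R[i]]_prelen.+1;
  nextv : 'cV[R[i]]_n.+1;
  subdiag : R[i];
  beta : R[i] }.

Definition mlen (R : realType) (n : nat) (D : decomp R n) : nat :=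
  (prelen D).+1.

Definition arnoldi_like (R : realType) (n : nat) (A : 'M[R[i]]_n.+1)
    (v : 'cV[R[i]]_n.+1) (D : decomp R n) : Prop :=
  [/\ A *m basis D = basis D *m hess D
                     + subdiag D *: (nextv D *m delta_mx 0 ord_max),
      forall i j : 'I_(prelen D).+1, (j.+1 < i)%N -> hess D i j = 0,
      \rank (basis D) = mlen D,
      ((basis D)^T :=: (krylov A v (mlen D))^T)%MS
    & v = beta D *: col ord0 (basis D)].

(* Column indices are 0-based: bb j is b_{j+1}.  [mgs bb w s] removes from w,
   successively (modified Gram-Schmidt), its components along bb i, i in s. *)
Definition mgs (R : realType) (n : nat) (bb : nat -> 'cV[R[i]]_n)
    (w : 'cV[R[i]]_n) (s : seq nat) : 'cV[R[i]]_n :=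
  foldl (fun u i => u - cdot (bb i) u *: bb i) w s.

(* The Arnoldi process in which A b_j is orthogonalized only against b_i for
   lo j <= i <= j (0-based). *)
Section Process.
Variables (R : realType) (n : nat).
Variables (A : 'M[R[i]]_n.+1) (lo : nat -> nat) (v : 'cV[R[i]]_n.+1).

Definition process_step (bb : nat -> 'cV[R[i]]_n.+1) (j : nat) :
    'cV[R[i]]_n.+1 :=
  mgs bb (A *m bb j) (iota (lo j) (j.+1 - lo j)).

Fixpoint process_seq (j : nat) : seq 'cV[R[i]]_n.+1 :=
  if j is j'.+1 then
    let Q := process_seq j' in
    let w := process_step (nth 0 Q) j' in
    rcons Q ((vnorm w)%:C^-1 *: w)
  else [:: (vnorm v)%:C^-1 *: v].

Definition process_vec (j : nat) : 'cV[R[i]]_n.+1 := nth 0 (process_seq j) j.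

Definition process_coef (i j : nat) : R[i] :=
  if i == j.+1 then (vnorm (process_step process_vec j))%:C
  else if (lo j <= i <= j)%N then
    cdot (process_vec i)
         (mgs process_vec (A *m process_vec j) (iota (lo j) (i - lo j)))
  else 0.

Definition process_basis (j : nat) : 'M[R[i]]_(n.+1, j) :=
  \matrix_(i < n.+1, l < j) process_vec l i 0.

Definition process_decomp (p : nat) : decomp R n :=
  Decomp (process_basis p.+1) (\matrix_(i, j) process_coef i j)
         (process_vec p.+1) (process_coef p.+1 p) (vnorm v)%:C.

End Process.

Definition arnoldi (R : realType) (n : nat) (A : 'M[R[i]]_n.+1) :=
  process_decomp A (fun=> 0%N).

(* 1-based, the lower end of the window is max(1, j - t + 1). *)
Definition trunc_lo (t j : nat) : nat := j.+1 - t.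

(* Spectral condition number, +oo if M does not have full column rank *)
Definition cond (R : realType) (s m : nat) (M : 'M[R[i]]_(s, m)) : \bar R :=
  let norms := [set r : R | exists2 x : 'cV[R[i]]_m,
                              vnorm x = 1 & r = vnorm (M *m x)] in
  if inf norms == 0 then +oo%E else (sup norms / inf norms)%:E.

(* The orthogonality required afterwards (perp_B or perp_AB below) determines c:
   c = (B^* B)^-1 B^* b_{m+1}, respectively
   c = ((AB)^* B)^-1 (AB)^* b_{m+1}.  The scaling alpha is left free. *)
Definition rank1_update (R : realType) (n : nat) (D D' : decomp R n) : Prop :=
  exists (c : 'cV[R[i]]_(prelen D).+1) (btilde : 'cV[R[i]]_n.+1)
    (alpha : R[i]),
  [/\ alpha != 0,
      nextv D = basis D *m c + alpha *: btilde
    & D' = Decomp (basis D) (hess D + subdiag D *: (c *m delta_mx 0 ord_max))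
             btilde (alpha * subdiag D) (beta D)].

Definition start (R : realType) (n : nat) (b : 'cV[R[i]]_n.+1)
    (D : nat -> decomp R n) (k : nat) : 'cV[R[i]]_n.+1 :=
  if k is k'.+1 then nextv (D k') else b.

Definition gamma (R : realType) (n : nat) (D : decomp R n) : R[i] :=
  (\prod_(j < prelen D) hess D (lift ord0 j) (widen_ord (leqnSn _) j))
  * subdiag D.

Definition phi (R : realType) (n : nat) (D : decomp R n) (t : R) : R[i] :=
  \det ((t%:C)%:M - hess D).

Fixpoint gk (R : realType) (n : nat) (g : R -> R) (D : nat -> decomp R n)
    (k : nat) (t : R) : R[i] :=
  if k is l.+1 then gamma (D l) * beta (D l) * gk g D l t / phi (D l) t
  else (g t)%:C.

(* err g D 0 is stieltjes_fun g = f *)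
Definition err (R : realType) (n : nat) (g : R -> R) (D : nat -> decomp R n)
    (k : nat) : R[i] -> R[i] :=
  stieltjes (gk g D k).

Definition correction (R : realType) (n : nat) (g : R -> R)
    (D : nat -> decomp R n) (k : nat) : 'cV[R[i]]_n.+1 :=
  basis (D k) *m matfun (err g D k) (hess (D k))
    *m (beta (D k) *: delta_mx ord0 0).

Fixpoint restart_approx (R : realType) (n : nat) (g : R -> R)
    (D : nat -> decomp R n) (k : nat) : 'cV[R[i]]_n.+1 :=
  if k is l.+1 then restart_approx g D l + correction g D k
  else correction g D 0%N.

Definition no_breakdown (R : realType) (n : nat) (A : 'M[R[i]]_n.+1)
    (b : 'cV[R[i]]_n.+1) (D : nat -> decomp R n) : Prop :=
  forall k j : nat, (j <= (mlen (D k)).+1)%N ->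
    \rank (krylov A (start b D k) j) = j.

Definition matfuns_defined (R : realType) (n : nat) (D : nat -> decomp R n) :
    Prop :=
  forall k : nat, spectrum_off_cut (hess (D k)).

(* Row i of the sketching matrix of cycle k is sk k i; when the basis has j + 1
   vectors, the first srows k j rows are in use.  Additional rows may be added
   as j grows. *)
Record sketching (R : realType) (n : nat) := Sketching {
  sk : nat -> nat -> 'rV[R[i]]_n.+1;
  srows : nat -> nat -> nat;
  srows_incr : forall k j : nat, (srows k j <= srows k j.+1)%N }.

Definition sketch (R : realType) (n : nat) (S : sketching R n) (k j : nat) :
    'M[R[i]]_(srows S k j, n.+1) :=
  \matrix_(i < srows S k j) sk S k i.

(* m is the first j >= 1 for which cond(S [b_1, ..., b_{j+1}]) exceeds tau,
   or m = mmax if this does not happen for j < mmax. *)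
Definition adaptive_length (R : realType) (n : nat) (A : 'M[R[i]]_n.+1)
    (t : nat) (S : sketching R n) (tau : R) (mmax k : nat)
    (v : 'cV[R[i]]_n.+1) (m : nat) : Prop :=
  let kappa j := cond (sketch S k j *m process_basis A (trunc_lo t) v j.+1) in
  [/\ (0 < m <= mmax)%N,
      forall j : nat, (0 < j < m)%N -> (kappa j <= tau%:E)%E
    & (m < mmax)%N -> (tau%:E < kappa m)%E].

(* A run of the restarted adaptive method; [perp D] is the orthogonality
   enforced on b_{m+1} by the rank-1 update. *)
Definition adaptive_run (R : realType) (n : nat) (perp : decomp R n -> Prop)
    (A : 'M[R[i]]_n.+1) (b : 'cV[R[i]]_n.+1)
    (t : nat) (S : sketching R n) (tau : R) (mmax : nat)
    (D : nat -> decomp R n) : Prop :=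
  forall k : nat,
  let v := start b D k in
  [/\ adaptive_length A t S tau (if k == 0%N then mmax else mlen (D 0%N)) k v
        (mlen (D k)),
      rank1_update (process_decomp A (trunc_lo t) v (prelen (D k))) (D k)
    & perp (D k)].

Definition perp_B (R : realType) (n : nat) (D : decomp R n) : Prop :=
  orthogonal_to (basis D) (nextv D).

Definition perp_AB (R : realType) (n : nat) (A : 'M[R[i]]_n.+1)
    (D : decomp R n) : Prop :=
  orthogonal_to (A *m basis D) (nextv D).

Definition arnoldi_run (R : realType) (n : nat) (A : 'M[R[i]]_n.+1)
    (b : 'cV[R[i]]_n.+1) (D : nat -> decomp R n) : Prop :=
  forall k : nat, D k = arnoldi A (start b D k) (prelen (D k)).

Definition AB_gram (R : realType) (n : nat) (A : 'M[R[i]]_n.+1)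
    (D : decomp R n) : 'M[R[i]]_((prelen D).+1) :=
  (A *m basis D)^t* *m basis D.

(* Since hess D = ((AB)^* B)^-1 (AB)^* (AB), the approximation
   B err^{[k]}(hess D) e_1 beta is the harmonic Arnoldi approximation. *)
Definition harmonic_cycle (R : realType) (n : nat) (A : 'M[R[i]]_n.+1)
    (v : 'cV[R[i]]_n.+1) (D : decomp R n) : Prop :=
  [/\ basis D = process_basis A (fun=> 0%N) v (mlen D),
      hess D = invmx (AB_gram A D) *m ((A *m basis D)^t* *m (A *m basis D)),
      arnoldi_like A v D /\ beta D = (vnorm v)%:C,
      ((nextv D)^T <= (krylov A v (mlen D).+1)^T)%MS
    & perp_AB A D].

Definition harmonic_run (R : realType) (n : nat) (A : 'M[R[i]]_n.+1)
    (b : 'cV[R[i]]_n.+1) (D : nat -> decomp R n) : Prop :=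
  forall k : nat, harmonic_cycle A (start b D k) (D k).

Definition same_lengths (R : realType) (n : nat) (D D' : nat -> decomp R n) :
    Prop :=
  forall k : nat, mlen (D k) = mlen (D' k).

Definition same_approx (R : realType) (n : nat) (g : R -> R)
    (D D' : nat -> decomp R n) : Prop :=
  forall k : nat, restart_approx g D k = restart_approx g D' k.

(* Main.v *)
From mathcomp Require Import all_boot all_order all_algebra.
From mathcomp Require Import complex.
From mathcomp Require Import all_classical all_reals all_analysis.
From mathcomp Require Import measurable_realfun ring lra.
Require Import Defs.

(** For a matrix whose spectrum avoids the cut, a Stieltjes function of the matrix
    is the integral of g(t) times the resolvent at t ([matfun_stieltjes]). With
    matrix functions defined through Hermite interpolation this needs an argument:
    the Newton interpolants of 1 / (t - x) at the eigenvalues have coefficients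
    that are products of resolvents in t, so they can be integrated over t
    coefficient by coefficient, and the derivatives of a Stieltjes transform are
    obtained by differentiation under the integral sign ([derive1n_Psi]).

    Hence every cycle is an integral over t of Krylov approximations to the
    shifted systems (t - A) x = b. The residuals of these approximations are all
    multiples of one vector, the next Krylov vector ([shift_residual]), and the
    multiples are exactly the factors by which the kernel is updated at a restart.

    For the equivalences, observe that a Krylov approximation is determined by its
    Krylov space and by the line of the next vector ([collinear_solve]). The
    truncated process spans the same Krylov space as the full one, and the
    orthogonality enforced by the rank-1 update fixes the line of the next vector
    inside the Krylov space of one dimension more ([nextv_collinear]). Cycle by
    cycle, the two methods then have the same residual for every shift
    ([same_residuals]); only the splitting of this residual into a scalar kernel
    and a starting vector differs.

    For the convergence, the error is the integral of g(t) times the errors of the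
    shifted systems ([restart_error]), so a geometric rate that is uniform in t
    suffices ([convergence_criterion]). If the next vector is orthogonal to the
    Krylov space and A is Hermitian positive definite, each cycle is a Galerkin
    step, which reduces the energy norm of A - t at least as much as a step of
    steepest descent ([arnoldi_rate]). If the next vector is orthogonal to the
    image of the Krylov space and A is positive real, each cycle minimizes the
    residual for t = 0; for t < 0 the residual is shorter still, because the
    harmonic Ritz values lie in the right half plane ([harmonic_rate]). *)

Set Implicit Arguments.
Unset Strict Implicit.
Unset Printing Implicit Defensive.
Import Order.TTheory GRing.Theory Num.Theory.
Import numFieldNormedType.Exports.
Local Open Scope classical_set_scope.
Local Open Scope ring_scope.
Local Open Scope complex_scope.
Local Open Scope sesquilinear_scope.

Local Notation Re := complex.Re.
Local Notation Im := complex.Im.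
Local Notation normc := Normc.normc.

(** * Complex numbers and the cut *)
Section ComplexFacts.
Variable R : realType.
Implicit Types x y z : R[i].

Lemma cReM x y : Re (x * y) = Re x * Re y - Im x * Im y.
Proof. by case: x => a b; case: y => c d. Qed.
Lemma cImM x y : Im (x * y) = Re x * Im y + Im x * Re y.
Proof. by case: x => a b; case: y => c d. Qed.
Lemma cReD x y : Re (x + y) = Re x + Re y.
Proof. by case: x => a b; case: y => c d. Qed.
Lemma cImD x y : Im (x + y) = Im x + Im y.
Proof. by case: x => a b; case: y => c d. Qed.
Lemma cReN x : Re (- x) = - Re x. Proof. by case: x. Qed.
Lemma cImN x : Im (- x) = - Im x. Proof. by case: x. Qed.
Lemma complexP x y : Re x = Re y -> Im x = Im y -> x = y.
Proof. by case: x => a b; case: y => c d /= -> ->. Qed.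

Lemma normc_ge0 x : 0 <= normc x.
Proof. by case: x => a b; exact: sqrtr_ge0. Qed.
Lemma normc_sqr x : normc x ^+ 2 = Re x ^+ 2 + Im x ^+ 2.
Proof. by case: x => a b /=; rewrite sqr_sqrtr // addr_ge0 ?sqr_ge0. Qed.
Lemma normcN x : normc (- x) = normc x.
Proof. by case: x => a b /=; rewrite !sqrrN. Qed.
Lemma normcM x y : normc (x * y) = normc x * normc y.
Proof. exact: Normc.normcM. Qed.
Lemma normcV x : normc x^-1 = (normc x)^-1.
Proof. exact: Normc.normcV. Qed.
Lemma le_normcD x y : normc (x + y) <= normc x + normc y.
Proof. exact: le_normcD. Qed.
Lemma normc_real (a : R) : normc a%:C = `|a|.
Proof. by rewrite /= expr0n addr0 sqrtr_sqr. Qed.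
Lemma normr_normc x : `|x| = (normc x)%:C.
Proof. by case: x. Qed.
Lemma normc_eq0 x : (normc x == 0) = (x == 0).
Proof.
apply/eqP/eqP => [|->]; first exact: Normc.eq0_normc.
by rewrite normc_real normr0.
Qed.
Lemma le_Re_normc x : `|Re x| <= normc x.
Proof.
rewrite -ler_sqr ?nnegrE ?normc_ge0 // normc_sqr real_normK ?num_real //.
by rewrite lerDl sqr_ge0.
Qed.
Lemma le_Im_normc x : `|Im x| <= normc x.
Proof.
rewrite -ler_sqr ?nnegrE ?normc_ge0 // normc_sqr real_normK ?num_real //.
by rewrite lerDr sqr_ge0.
Qed.
Lemma normc_le x : normc x <= `|Re x| + `|Im x|.
Proof.
rewrite -ler_sqr ?nnegrE ?normc_ge0 ?addr_ge0 // normc_sqr.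
rewrite -(real_normK (num_real (Re x))) -(real_normK (num_real (Im x))).
rewrite sqrrD -addrA lerD2l lerDr.
by rewrite mulrn_wge0 // mulr_ge0.
Qed.
Lemma normc_sum (I : Type) (r : seq I) (p : pred I) (F : I -> R[i]) :
  normc (\sum_(i <- r | p i) F i) <= \sum_(i <- r | p i) normc (F i).
Proof.
elim/big_rec2: _ => [|i u v _ h]; first by rewrite normc_real normr0.
by apply: le_trans (le_normcD _ _) _; rewrite lerD2l.
Qed.
Lemma normcX x k : normc (x ^+ k) = normc x ^+ k.
Proof.
by elim: k => [|k IH]; rewrite ?expr0 ?normc_real ?normr1 // !exprS normcM IH.
Qed.
Lemma le0c_ReIm z : (z <= 0) = (Re z <= 0) && (Im z == 0).
Proof. by rewrite lecE /= eq_sym andbC. Qed.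

(** Seen from a point off the cut, the distance to t grows at least linearly as
    t tends to minus infinity; this single bound gives the decay of resolvents
    and, through it, all integrability statements. *)
Lemma off_cut_dist z : ~~ (z <= 0) ->
  exists2 d : R, 0 < d & forall t : R, t <= 0 -> d * (1 - t) <= normc (t%:C - z).
Proof.
rewrite le0c_ReIm negb_and -ltNge.
have hR (t : R) : `|Re z - t| <= normc (t%:C - z).
  by apply: le_trans (le_Re_normc _); rewrite cReD cReN distrC.
have hI (t : R) : `|Im z| <= normc (t%:C - z).
  by apply: le_trans (le_Im_normc _); rewrite cImD cImN add0r normrN.
set a := Re z in hR *; set b := Im z in hI * => /orP[a0|b0].
- pose d := Num.min 1 a; exists d; first by rewrite lt_min ltr01.
  have [d1 d2] : d <= 1 /\ d <= a by split; rewrite ge_min lexx ?orbT.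
  have d0 : 0 < d by rewrite lt_min ltr01.
  move=> t t0; apply: le_trans (hR t); rewrite ger0_norm; nra.
- pose c := Num.max 1 (2 * (1 + `|a|)).
  have c1 : 1 <= c by rewrite le_max lexx.
  have c2 : 2 * (1 + `|a|) <= c by rewrite le_max lexx orbT.
  have b1 : 0 < `|b| by rewrite normr_gt0.
  (* either |t - a| >= (1 - t) / 2, or 1 - t <= c *)
  pose d := Num.min (1 / 2) (`|b| / c).
  have d0 : 0 < d by rewrite lt_min divr_gt0 ?ltr01 // divr_gt0 //; lra.
  have [d1 d2] : d <= 1 / 2 /\ d <= `|b| / c by split; rewrite ge_min lexx ?orbT.
  exists d => // t t0; have [h|h] := leP (1 - t) c.
    apply: le_trans (hI t).
    have : d * (1 - t) <= `|b| / c * c by apply: ler_pM; lra.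
    by rewrite divfK //; lra.
  apply: le_trans (hR t).
  have h1 : d * (1 - t) <= 1 / 2 * (1 - t) by rewrite ler_wpM2r //; lra.
  apply: le_trans h1 _.
  have := ler_norm (a - t).
  have := lerNnormlW (lexx `|a|); lra.
Qed.

Lemma off_cut_sub z (t : R) : ~~ (z <= 0) -> t <= 0 -> t%:C - z != 0.
Proof.
by move=> hz t0; apply: contraNneq hz => /eqP; rewrite subr_eq0 => /eqP <-; rewrite lecR.
Qed.

End ComplexFacts.

(** * Integration against a Stieltjes density *)
Section Integral.
Variable R : realType.
Implicit Types (q : R -> R[i]).
Local Notation mu := (@lebesgue_measure R).
Local Notation P := (`]-oo, 0%R]%classic : set R).

Definition cint q : R[i] :=
  Rintegral mu P (fun t => Re (q t)) +i* Rintegral mu P (fun t => Im (q t)).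

(** Order zero means bounded, order one means integrable against every Stieltjes
    density. Orders add under products, so that every rational function of t
    met below is handled by algebra alone. *)
Definition tame (j : nat) q : Prop :=
  [/\ measurable_fun P (fun t => Re (q t)), measurable_fun P (fun t => Im (q t))
    & exists M : R, forall t, t <= 0 -> (1 - t) ^+ j * normc (q t) <= M].

Lemma measurable_nonpos : measurable P. Proof. exact: measurable_itv. Qed.

Lemma nonposE t : (P t) = (t <= 0) :> Prop.
Proof. by rewrite /= in_itv. Qed.

Lemma tame_cst c : tame 0 (fun=> c).
Proof.
split; try exact: measurable_cst.
by exists (normc c) => t _; rewrite expr0 mul1r.
Qed.

Lemma tameM i j p q : tame i p -> tame j q -> tame (i + j) (fun t => p t * q t).
Proof.
move=> [mp1 mp2 [M hM]] [mq1 mq2 [N hN]]; split.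
- rewrite (_ : (fun t => _) = fun t => Re (p t) * Re (q t) - Im (p t) * Im (q t));
    last by apply/funext => t; rewrite cReM.
  by apply: measurable_funB; apply: measurable_funM.
- rewrite (_ : (fun t => _) = fun t => Re (p t) * Im (q t) + Im (p t) * Re (q t));
    last by apply/funext => t; rewrite cImM.
  by apply: measurable_funD; apply: measurable_funM.
exists (M * N) => t t0; rewrite normcM exprD mulrACA.
have h : 0 <= 1 - t by lra.
by rewrite ler_pM ?hM ?hN // mulr_ge0 ?normc_ge0 ?exprn_ge0.
Qed.

Lemma tameD j p q : tame j p -> tame j q -> tame j (fun t => p t + q t).
Proof.
move=> [mp1 mp2 [M hM]] [mq1 mq2 [N hN]]; split.
- rewrite (_ : (fun t => _) = fun t => Re (p t) + Re (q t)).
    exact: measurable_funD.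
  by apply/funext => t; rewrite cReD.
- rewrite (_ : (fun t => _) = fun t => Im (p t) + Im (q t)).
    exact: measurable_funD.
  by apply/funext => t; rewrite cImD.
exists (M + N) => t t0; apply: le_trans (lerD (hM t t0) (hN t t0)).
rewrite -mulrDr ler_wpM2l ?le_normcD // exprn_ge0 //; lra.
Qed.

Lemma tameZ j c q : tame j q -> tame j (fun t => c * q t).
Proof. exact: (tameM (tame_cst c)). Qed.

Lemma tameB j p q : tame j p -> tame j q -> tame j (fun t => p t - q t).
Proof.
move=> hp hq; have := tameD hp (tameZ (-1) hq).
by under eq_fun do rewrite mulN1r.
Qed.

Lemma tameW i j q : (i <= j)%N -> tame j q -> tame i q.
Proof.
move=> ij [m1 m2 [M hM]]; split=> //; exists M => t t0.
apply: le_trans (hM t t0); rewrite ler_wpM2r ?normc_ge0 // ler_weXn2l //.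
lra.
Qed.

Lemma eq_tame j p q : (forall t, t <= 0 -> p t = q t) -> tame j p -> tame j q.
Proof.
move=> h [m1 m2 [M hM]]; split.
- by apply: eq_measurable_fun m1 => t; rewrite inE nonposE => /h ->.
- by apply: eq_measurable_fun m2 => t; rewrite inE nonposE => /h ->.
- by exists M => t t0; rewrite -h // hM.
Qed.

Lemma tame_zero j : tame j (fun=> 0).
Proof.
split; try exact: measurable_cst.
by exists 0 => t _; rewrite normc_real normr0 mulr0.
Qed.

Lemma tame_sum j (I : Type) (r : seq I) (F : I -> R -> R[i]) :
  (forall i, tame j (F i)) -> tame j (fun t => \sum_(i <- r) F i t).
Proof.
move=> h; elim: r => [|a r IH].
  rewrite (_ : (fun t => _) = fun=> 0); first exact: tame_zero.
  by apply/funext => t; rewrite big_nil.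
rewrite (_ : (fun t => _) = fun t => F a t + \sum_(i <- r) F i t).
  exact: tameD.
by apply/funext => t; rewrite big_cons.
Qed.

(** On nonnegative numbers the inverse is the power with exponent -1. *)
Lemma measurable_inv_pos (f : R -> R) : measurable_fun P f ->
  (forall t, t <= 0 -> 0 <= f t) -> measurable_fun P (fun t => (f t)^-1).
Proof.
move=> mf f0.
apply: (eq_measurable_fun (fun t => f t `^ (-1))) => [t|].
  by rewrite inE nonposE => /f0 ft; rewrite /= powR_inv1.
apply: (measurableT_comp (measurable_powR _)) => //.
Qed.

Lemma tame_resolvent z : ~~ (z <= 0) -> tame 1 (fun t : R => (t%:C - z)^-1).
Proof.
move=> hz; have [d d0 hd] := off_cut_dist hz.
have pos t : t <= 0 -> 0 < normc (t%:C - z).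
  by move=> t0; apply: lt_le_trans (hd _ t0); rewrite mulr_gt0 //; lra.
have mid : measurable_fun P (fun t : R => t - Re z).
  by apply: measurable_funB; [exact: measurable_id|exact: measurable_cst].
have mn : measurable_fun P (fun t : R => ((t - Re z) ^+ 2 + Im z ^+ 2)^-1).
  apply: measurable_inv_pos => [|t t0]; last by rewrite addr_ge0 ?sqr_ge0.
  apply: measurable_funD; last exact: measurable_cst.
  exact: measurable_funX.
split.
- have -> : (fun t : R => Re (t%:C - z)^-1) =
    (fun t : R => (t - Re z) * ((t - Re z) ^+ 2 + Im z ^+ 2)^-1).
    apply/funext => t; case: (z) => a b /=; by rewrite sub0r sqrrN.
  exact: measurable_funM.
- have -> : (fun t : R => Im (t%:C - z)^-1) =
    (fun t : R => Im z * ((t - Re z) ^+ 2 + Im z ^+ 2)^-1).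
    apply/funext => t; case: (z) => a b /=; by rewrite sub0r sqrrN mulNr opprK.
  by apply: measurable_funM => //; exact: measurable_cst.
- exists d^-1 => t t0; rewrite expr1 normcV ler_pdivrMr ?pos //.
  by rewrite mulrC ler_pdivlMr // mulrC hd.
Qed.

Lemma eq_cint p q : (forall t, t <= 0 -> p t = q t) -> cint p = cint q.
Proof.
move=> h; rewrite /cint; congr (_ +i* _); apply: eq_Rintegral => t;
by rewrite inE nonposE => /h ->.
Qed.

Section Density.
Variables (g : R -> R).
Hypothesis gS : stieltjes_density g.

Definition stint q : R[i] := cint (fun t => (g t)%:C * q t).

Lemma eq_stint p q : (forall t, t <= 0 -> p t = q t) -> stint p = stint q.
Proof. by move=> h; apply: eq_cint => t t0; rewrite h. Qed.

(** Every tame function of order one times the density is dominated by a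
    multiple of this weight, which comes from the point z = 1. *)
Lemma density_weight : mu.-integrable P (fun t => (g t / (t - 1))%:E).
Proof.
have n1 : ~~ ((1 : R[i]) <= 0) by rewrite lt_geF ?ltr01.
have [+ _] := gS.2 _ n1.
rewrite (_ : (fun t => _) = (fun t => (g t / (t - 1))%:E)) //.
apply/funext => t; rewrite -[1 in LHS](@rmorph1 _ _ (real_complex R)) -rmorphB.
by rewrite -fmorphV -rmorphM.
Qed.

Lemma measurable_density : measurable_fun P g.
Proof.
apply: (eq_measurable_fun (fun t => g t / (t - 1) * (t - 1))) => [t|].
  by rewrite inE nonposE => t0; rewrite divfK // lt_eqF //; lra.
apply: measurable_funM.
  have /integrableP[+ _] := density_weight.
  by move=> /measurable_EFinP.
by apply: measurable_funB; [exact: measurable_id|exact: measurable_cst].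
Qed.

Lemma integrable_density (h : R -> R) (M : R) : measurable_fun P h ->
  (forall t, t <= 0 -> (1 - t) * `|h t| <= M) ->
  mu.-integrable P (fun t => (g t * h t)%:E).
Proof.
move=> mh hM.
have M0 : 0 <= M.
  by apply: le_trans (hM 0 (lexx _)); rewrite mulr_ge0 //; lra.
have := @integrableZl _ _ _ mu _ measurable_nonpos M _ density_weight.
apply: le_integrable => //.
  by apply/measurable_EFinP; apply: measurable_funM => //; exact: measurable_density.
move=> t; rewrite nonposE => t0 /=.
rewrite lee_fin !normrM (ger0_norm M0).
rewrite [leRHS]mulrCA ler_wpM2l // normfV distrC.
have p0 : 0 < 1 - t by lra.
by rewrite (ger0_norm (ltW p0)) ler_pdivlMr // mulrC hM.
Qed.

Lemma integrable_stint q : tame 1 q ->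
  mu.-integrable P (EFin \o (fun t => g t * Re (q t))) /\
  mu.-integrable P (EFin \o (fun t => g t * Im (q t))).
Proof.
move=> [m1 m2 [M hM]].
split; apply: (@integrable_density _ M) => // t t0;
  apply: le_trans (hM t t0); rewrite expr1 ler_wpM2l ?le_Re_normc ?le_Im_normc //;
  lra.
Qed.

Lemma stintE q : stint q =
  Rintegral mu P (fun t => g t * Re (q t)) +i*
  Rintegral mu P (fun t => g t * Im (q t)).
Proof.
rewrite /stint /cint; congr (_ +i* _); apply: eq_Rintegral => t _.
  by rewrite cReM /= mul0r subr0.
by rewrite cImM /= mul0r addr0.
Qed.

Lemma stintD p q : tame 1 p -> tame 1 q ->
  stint (fun t => p t + q t) = stint p + stint q.
Proof.
move=> /integrable_stint[p1 p2] /integrable_stint[q1 q2].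
rewrite !stintE; apply: complexP; rewrite ?cReD ?cImD /=.
  rewrite -RintegralD //; apply: eq_Rintegral => t _.
  by rewrite cReD mulrDr.
rewrite -RintegralD //; apply: eq_Rintegral => t _.
by rewrite cImD mulrDr.
Qed.

Lemma stintZ c q : tame 1 q -> stint (fun t => c * q t) = c * stint q.
Proof.
pose scaleI a (f : R -> R) := @RintegralZl _ _ _ mu _ f a measurable_nonpos.
have scaleL a (f : R -> R) : mu.-integrable P (EFin \o f) ->
    mu.-integrable P (EFin \o (fun t => a * f t)).
  exact: (@integrableZl _ _ _ mu _ measurable_nonpos).
move=> /integrable_stint[q1 q2].
rewrite !stintE; apply: complexP; rewrite ?cReM ?cImM /=.
  rewrite -(scaleI (Re c) _ q1) -(scaleI (Im c) _ q2) -RintegralB;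
    [|exact: measurable_nonpos|exact: (scaleL _ _ q1)|exact: (scaleL _ _ q2)].
  by apply: eq_Rintegral => t _; rewrite cReM; ring.
rewrite -(scaleI (Re c) _ q2) -(scaleI (Im c) _ q1) -RintegralD;
  [|exact: measurable_nonpos|exact: (scaleL _ _ q2)|exact: (scaleL _ _ q1)].
by apply: eq_Rintegral => t _; rewrite cImM; ring.
Qed.

Lemma stint0 : stint (fun=> 0) = 0.
Proof.
by have := stintZ 0 (tame_zero 1); rewrite !mul0r.
Qed.

Lemma stintB p q : tame 1 p -> tame 1 q ->
  stint (fun t => p t - q t) = stint p - stint q.
Proof.
move=> hp hq; rewrite -mulN1r -stintZ // -stintD //; last exact: tameZ.
by apply: eq_stint => t _; rewrite mulN1r.
Qed.

Lemma stint_sum (I : Type) (r : seq I) (F : I -> R -> R[i]) :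
  (forall i, tame 1 (F i)) ->
  stint (fun t => \sum_(i <- r) F i t) = \sum_(i <- r) stint (F i).
Proof.
move=> h; elim: r => [|a r IH].
  by rewrite big_nil -[RHS]stint0; apply: eq_stint => t _; rewrite big_nil.
rewrite big_cons -IH -stintD //; last exact: tame_sum.
by apply: eq_stint => t _; rewrite big_cons.
Qed.

(** Bounds every integral against g of a function with (1 - t) |q t| <= 1, up to
    the factor two that comes from treating real and imaginary parts apart. *)
Definition mass : R := Rintegral mu P (fun t => `|g t / (t - 1)|).

Lemma mass_ge0 : 0 <= mass.
Proof. by apply: Rintegral_ge0 => t _; exact: normr_ge0. Qed.

Lemma density_bound (h : R -> R) (M : R) : measurable_fun P h ->
  (forall t, t <= 0 -> (1 - t) * `|h t| <= M) ->
  `|Rintegral mu P (fun t => g t * h t)| <= M * mass.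
Proof.
move=> mh hM; have hi := integrable_density mh hM.
apply: le_trans (@le_normr_Rintegral _ _ _ mu _ _ measurable_nonpos hi) _.
have wi := @integrable_norm _ _ _ mu _ _ density_weight.
rewrite /mass -(@RintegralZl _ _ _ mu _ _ M measurable_nonpos wi).
apply: (@le_Rintegral _ _ _ mu _ _ _ measurable_nonpos (@integrable_norm _ _ _ mu _ _ hi)).
  exact: (@integrableZl _ _ _ mu _ measurable_nonpos M _ wi).
move=> t; rewrite nonposE => t0 /=.
rewrite !normrM mulrCA ler_wpM2l // normfV distrC.
have p0 : 0 < 1 - t by lra.
by rewrite (ger0_norm (ltW p0)) ler_pdivlMr // mulrC hM.
Qed.

Lemma stint_bound q M : tame 1 q ->
  (forall t, t <= 0 -> (1 - t) * normc (q t) <= M) ->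
  normc (stint q) <= 2 * M * mass.
Proof.
move=> [m1 m2 _] hM; apply: le_trans (normc_le _) _.
rewrite stintE -mulrA mulr_natl mulr2n /=.
apply: lerD; apply: density_bound => // t t0; apply: le_trans (hM t t0);
  rewrite ler_wpM2l ?le_Re_normc ?le_Im_normc //; lra.
Qed.

End Density.

End Integral.

(** * Derivatives of a Stieltjes transform *)
Section Derivatives.
Variable R : realType.
Implicit Types (z w : R[i]) (t : R).

Lemma subX_bound (a b : R[i]) (M : R) k : normc a <= M -> normc b <= M ->
  normc (a ^+ k.+1 - b ^+ k.+1) <= k.+1%:R * M ^+ k * normc (a - b).
Proof.
move=> aM bM; have M0 : 0 <= M := le_trans (normc_ge0 a) aM.
rewrite subrXX normcM mulrC ler_wpM2r ?normc_ge0 //.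
apply: le_trans (normc_sum _ _ _) _.
rewrite -[X in X%:R](card_ord k.+1) mulr_natl -sumr_const.
apply: ler_sum => i _; rewrite normcM !normcX /=.
have ik : (i <= k)%N by rewrite -ltnS.
rewrite -[in leRHS](subnK ik) exprD ler_pM ?exprn_ge0 ?normc_ge0 //.
  by rewrite lerXn2r ?nnegrE ?normc_ge0.
by rewrite lerXn2r ?nnegrE ?normc_ge0.
Qed.

(** The decay of the resolvent is uniform in a neighbourhood of z. *)
Lemma off_cut_nbhs z : ~~ (z <= 0) -> exists r M : R, [/\ 0 < r, 0 <= M &
  forall w, normc (w - z) < r -> ~~ (w <= 0) /\
    forall t, t <= 0 -> (1 - t) * normc (t%:C - w)^-1 <= M].
Proof.
move=> hz; have [d d0 hd] := off_cut_dist hz.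
exists (d / 2), (2 / d); split=> [||w hw]; first by rewrite divr_gt0.
  by rewrite divr_ge0 // ltW.
have key t : t <= 0 -> d / 2 * (1 - t) <= normc (t%:C - w).
  move=> t0; have := le_normcD (t%:C - w) (w - z).
  rewrite addrA subrK => h; have := hd t t0.
  have : d * t <= 0 by rewrite mulr_ge0_le0 // ltW.
  lra.
split.
  apply/negP; rewrite le0c_ReIm => /andP[w0 /eqP w1].
  have := key _ w0; rewrite (_ : (Re w)%:C - w = 0); last first.
    by apply: complexP; rewrite ?cReD ?cImD ?cReN ?cImN ?w1 /= subrr.
  rewrite normc_real normr0 leNgt mulr_gt0 ?divr_gt0 //; lra.
move=> t t0.
have p0 : 0 < d / 2 * (1 - t) by rewrite mulr_gt0 ?divr_gt0 //; lra.
rewrite normcV ler_pdivrMr ?(lt_le_trans p0 (key t t0)) //.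
rewrite -ler_pdivrMl ?divr_gt0 // invf_div.
exact: key.
Qed.

Variables (g : R -> R) (rho : R -> R[i]).
Hypotheses (gS : stieltjes_density g) (trho : tame 0 rho).

(** Up to the factor j!, this is the j-th derivative of the Stieltjes transform
    of g times rho. *)
Definition Psi (j : nat) z : R[i] :=
  stint g (fun t => rho t * (t%:C - z)^-1 ^+ j.+1).

Lemma tame_Xresolvent j z : ~~ (z <= 0) -> tame j (fun t => (t%:C - z)^-1 ^+ j).
Proof.
move=> hz; elim: j => [|j IH]; first exact: tame_cst.
under eq_fun do rewrite exprS.
exact: (tameM (tame_resolvent hz) IH).
Qed.

Lemma tame_Psi j z : ~~ (z <= 0) -> tame 1 (fun t => rho t * (t%:C - z)^-1 ^+ j.+1).
Proof.
move=> hz; apply: (@tameW _ _ j.+1) => //.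
exact: (tameM trho (tame_Xresolvent j.+1 hz)).
Qed.

(** Differentiation under the integral sign. With a = 1 / (t - w) and
    b = 1 / (t - z) one has a - b = (w - z) a b, so the difference quotient is an
    explicit sum of products of a and b, and it differs from its limit by
    O(|w - z|), uniformly in t. *)
Lemma Psi_quotient j z : ~~ (z <= 0) -> exists r K : R, [/\ 0 < r, 0 <= K &
  forall w, normc (w - z) < r -> ~~ (w <= 0) /\ (w != z ->
    normc ((w - z)^-1 * (Psi j w - Psi j z) - j.+1%:R * Psi j.+1 z)
      <= K * normc (w - z))].
Proof.
move=> hz; have [r [M [r0 M0 hM]]] := off_cut_nbhs hz.
have [_ _ [N hN]] := trho.
have N0 : 0 <= N by have := hN 0 (lexx _); apply: le_trans; rewrite mulr_ge0 ?normc_ge0.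
pose L := N * (M * ((j.+1%:R * (j.+1%:R * M ^+ j)) * M ^+ 2)).
have L0 : 0 <= L by rewrite !(mulr_ge0, exprn_ge0, ler0n).
exists r, (2 * L * mass g); split=> //; first by rewrite mulr_ge0 ?mass_ge0 // mulr_ge0.
move=> w /[dup] wr /hM[hw bw]; split=> // wz.
have /hM[_ bz] : normc (z - z) < r by rewrite subrr normc_real normr0.
have wz0 : w - z != 0 by rewrite subr_eq0.
pose D t := rho t * ((t%:C - z)^-1 * \sum_(i < j.+1)
  ((t%:C - w)^-1 ^+ (j - i).+1 * (t%:C - z)^-1 ^+ i - (t%:C - z)^-1 ^+ j.+1)).
have ED : (w - z)^-1 * (Psi j w - Psi j z) - j.+1%:R * Psi j.+1 z = stint g D.
  rewrite /Psi -stintB //; try exact: tame_Psi.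
  rewrite -!stintZ // -?stintB //; try exact: tame_Psi.
  - apply: eq_stint => t t0; rewrite /D -mulrBr !(mulrCA _ (rho t)) -mulrBr.
    congr (rho t * _); rewrite subrXX mulrA.
    set a := (t%:C - w)^-1; set b := (t%:C - z)^-1.
    have -> : (w - z)^-1 * (a - b) = a * b.
      rewrite /a /b; have := off_cut_sub hw t0; have := off_cut_sub hz t0; move: wz0.
      by move=> h1 h2 h3; field; rewrite ?h1 ?h2 ?h3.
    rewrite sumrB sumr_const card_ord [RHS]mulrBr -[_ ^+ _ *+ _]mulr_natl [b ^+ j.+2]exprS.
    rewrite (mulrCA b); congr (_ - _).
    rewrite [RHS]mulr_sumr [LHS]mulr_sumr; apply: eq_bigr => i _.
    by rewrite /= exprS; ring.
  - by apply/tameZ/tameB; exact: tame_Psi.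
  - by apply: tameZ; exact: tame_Psi.
  - by apply: tameB; exact: tame_Psi.
rewrite ED; apply: le_trans (@stint_bound _ _ gS _ (L * normc (w - z)) _ _) _.
- apply: (@tameW _ _ (0 + (1 + 0))) => //; apply: tameM trho _.
  apply: tameM; first exact: tame_resolvent.
  apply: tame_sum => i; apply: tameB; last first.
    by apply: (@tameW _ _ j.+1) => //; exact: tame_Xresolvent.
  apply: (@tameW _ _ ((j - i).+1 + i)) => //.
  by apply: tameM; exact: tame_Xresolvent.
- move=> t t0; rewrite /D.
  set a := (t%:C - w)^-1; set b := (t%:C - z)^-1.
  have p1 : 1 <= 1 - t by lra.
  have aM : (1 - t) * normc a <= M by exact: bw.
  have bM : (1 - t) * normc b <= M by exact: bz.
  have aM' : normc a <= M.
    by apply: le_trans aM; rewrite ler_peMl ?normc_ge0.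
  have bM' : normc b <= M.
    by apply: le_trans bM; rewrite ler_peMl ?normc_ge0.
  have ab : normc (a - b) <= M ^+ 2 * normc (w - z).
    have -> : a - b = (w - z) * (a * b).
      rewrite /a /b; have := off_cut_sub hw t0; have := off_cut_sub hz t0; move: wz0.
      by move=> h1 h2 h3; field; rewrite ?h1 ?h2 ?h3.
    rewrite mulrC !normcM ler_wpM2r ?normc_ge0 // expr2.
    by rewrite ler_pM ?normc_ge0.
  have sum_le : normc (\sum_(i < j.+1) (a ^+ (j - i).+1 * b ^+ i - b ^+ j.+1))
      <= j.+1%:R * (j.+1%:R * M ^+ j) * (M ^+ 2 * normc (w - z)).
    apply: le_trans (normc_sum _ _ _) _.
    rewrite -mulrA -[X in X%:R * _](card_ord j.+1) [leRHS]mulr_natl -sumr_const.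
    apply: ler_sum => i _.
    have ij : (i <= j)%N by rewrite -ltnS.
    have -> : b ^+ j.+1 = b ^+ (j - i).+1 * b ^+ i by rewrite -exprD addSn subnK.
    rewrite -mulrBl normcM mulrC normcX.
    have h1 : normc b ^+ i <= M ^+ i by rewrite lerXn2r ?nnegrE ?normc_ge0.
    apply: le_trans (ler_pM _ _ h1 (subX_bound (j - i) aM' bM')) _.
    + by rewrite exprn_ge0 ?normc_ge0.
    + exact: normc_ge0.
    have -> : M ^+ i * ((j - i).+1%:R * M ^+ (j - i) * normc (a - b)) =
      (j - i).+1%:R * M ^+ j * normc (a - b).
      by rewrite -[X in _ = _ * M ^+ X * _](subnKC ij) exprD; ring.
    rewrite ler_pM ?mulr_ge0 ?exprn_ge0 ?normc_ge0 ?ler0n // ler_wpM2r ?exprn_ge0 //.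
      by rewrite ler_nat ltnS leq_subr.
  have NN : normc (rho t) <= N by have := hN t t0; rewrite expr0 mul1r.
  rewrite !normcM mulrCA.
  have -> : L * normc (w - z) = N * (M *
    (j.+1%:R * (j.+1%:R * M ^+ j) * (M ^+ 2 * normc (w - z)))) by rewrite /L; ring.
  have t1 : 0 <= 1 - t by lra.
  apply: ler_pM => //; try by rewrite ?mulr_ge0 ?normc_ge0.
  rewrite [leLHS]mulrA; apply: (ler_pM _ _ bM sum_le); last exact: normc_ge0.
  by apply: mulr_ge0 => //; exact: normc_ge0.
by rewrite le_eqVlt; apply/orP; left; apply/eqP; ring.
Qed.

Lemma derive1_Psi (f : (R[i] : numFieldType) -> (R[i] : numFieldType)) j c z :
  ~~ (z <= 0) -> (forall w, ~~ (w <= 0) -> f w = c * Psi j w) ->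
  derive1 f z = c * (j.+1%:R * Psi j.+1 z).
Proof.
move=> hz hf; have [r [K [r0 K0 hK]]] := Psi_quotient j hz.
rewrite /derive1; apply: cvg_lim; first exact: norm_hausdorff.
apply/cvgrPdist_le => e e0.
pose K' := normc c * K + 1.
have K'0 : 0 < K' by rewrite ltr_wpDl // mulr_ge0 ?normc_ge0.
have e_real : e = (Re e)%:C.
  by apply: complexP => //=; move: e0; rewrite ltcE /= => /andP[/eqP ->].
have Re0 : 0 < Re e by move: e0; rewrite ltcE /= => /andP[].
pose d := Num.min r (Re e / K').
have d0 : 0 < d by rewrite lt_min r0 divr_gt0.
near=> h.
have hd : normc h < d.
  rewrite -ltcR -normr_normc; near: h; apply: dnbhs0_lt; by rewrite ltcR.
have h0 : h != 0 by near: h; exact: nbhs_dnbhs_neq.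
have [hr hs] : normc h < r /\ normc h < Re e / K'.
  by move: hd; rewrite lt_min => /andP[].
have /hK[hw] : normc (h + z - z) < r by rewrite addrK.
rewrite -subr_eq0 addrK => /(_ h0) hq.
rewrite distrC e_real normr_normc lecR !hf // -mulrBr.
have -> : h^-1 *: (c * (Psi j (h + z) - Psi j z)) - c * (j.+1%:R * Psi j.+1 z) =
  c * (h^-1 * (Psi j (h + z) - Psi j z) - j.+1%:R * Psi j.+1 z).
  by rewrite -[h^-1 *: _]/(h^-1 * _) mulrCA -mulrBr.
rewrite normcM.
apply: le_trans (ler_wpM2l (normc_ge0 c) hq) _.
rewrite mulrA; apply: le_trans (_ : K' * (Re e / K') <= _); last first.
  by rewrite mulrC divfK // gt_eqF.
apply: ler_pM; rewrite ?mulr_ge0 ?normc_ge0 //; last exact: ltW.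
by rewrite lerDl.
Unshelve. all: by end_near.
Qed.

Lemma derive1n_Psi (f : (R[i] : numFieldType) -> (R[i] : numFieldType)) j z :
  ~~ (z <= 0) -> (forall w, ~~ (w <= 0) -> f w = Psi 0 w) ->
  derive1n j f z = j`!%:R * Psi j z.
Proof.
move=> + hf; elim: j z => [|j IH] z hz; first by rewrite derive1n0 fact0 mul1r hf.
rewrite derive1nS (derive1_Psi hz IH) factS natrM; ring.
Qed.

End Derivatives.

(** * Interpolation of resolvents by polynomials *)
Section Polynomials.
Variable F : fieldType.
Implicit Types (p q u : {poly F}) (x : F).

Lemma derivn_XsubCM u x j m : (j <= m)%N ->
  (derivn j (u * ('X - x%:P) ^+ m)).[x] = if j == m then m`!%:R * u.[x] else 0.
Proof.
elim: m u j => [|m IH] u [|j] //.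
- by rewrite expr0 mulr1 derivn0 fact0 mul1r.
- by move=> _; rewrite derivn0 !hornerE subrr expr0n /= mulr0.
rewrite ltnS eqSS => jm; rewrite derivSn.
rewrite derivM deriv_exp derivXsubC mul1r /=.
rewrite (_ : _ + _ = (u^`() * ('X - x%:P) + u *+ m.+1) * ('X - x%:P) ^+ m).
  rewrite IH //; case: eqP => // _.
  by rewrite factS natrM !hornerE subrr mulr0 add0r hornerMn -mulr_natl; ring.
by rewrite mulrDl -mulrA -exprS mulrnAr mulrnAl.
Qed.

(** Leibniz's rule has two terms only, as the first factor has degree one. *)
Lemma derivn_linear_mul (c : F) p j :
  derivn j.+1 ((c%:P - 'X) * p) =
    (c%:P - 'X) * derivn j.+1 p - (derivn j p) *+ j.+1.
Proof.
elim: j => [|j IH].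
  by rewrite derivn1 derivM derivB derivC derivX derivn0 derivn1 sub0r mulN1r addrC.
rewrite derivnS IH derivB derivMn derivM -!derivnS derivB derivC derivX sub0r.
by rewrite mulN1r -addrA addrCA [(_ *+ _.+2)]mulrS opprD.
Qed.

Lemma dvd_prod_XsubC (s : seq F) q : q != 0 ->
  (forall x, count_mem x s <= mup x q)%N -> \prod_(x <- s) ('X - x%:P) %| q.
Proof.
elim: s q => [|x s IH] q q0 h; first by rewrite big_nil dvd1p.
have : 'X - x%:P %| q.
  by rewrite XsubC_dvd //; apply: leq_trans (h x); rewrite /= eqxx.
case/dvdpP => r Er; rewrite big_cons Er mulrC dvdp_mul2r ?polyXsubC_eq0 //.
have r0 : r != 0 by apply: contraNneq q0 => r0; rewrite Er r0 mul0r.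
apply: IH => // y; have := h y.
rewrite Er mupM ?polyXsubC_eq0 // -['X - x%:P]expr1 mup_XsubCX /= eq_sym.
by case: eqP => _; rewrite ?add1n ?addn1 ?add0n ?addn0.
Qed.

(** Newton's form of the polynomial in x that interpolates 1 / (c - x) at the
    nodes s. Its coefficients, the divided differences, are products of the
    numbers 1 / (c - s_k), so they can be integrated over c. *)
Definition newton_basis (s : seq F) k : {poly F} := \prod_(i < k) ('X - (s`_i)%:P).
Definition newton_coef (s : seq F) (c : F) k : F := \prod_(i < k) (c - s`_i)^-1.

(** Since c - x = (c - s_k) - (x - s_k), the sum telescopes. *)
Lemma newton_identity (s : seq F) (c : F) :
  (forall x, x \in s -> c - x != 0) ->
  (c%:P - 'X) * (\sum_(k < size s) newton_coef s c k.+1 *: newton_basis s k) =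
  1 - newton_coef s c (size s) *: newton_basis s (size s).
Proof.
move=> h.
rewrite mulr_sumr.
rewrite (eq_bigr (fun k : 'I_(size s) => newton_coef s c k *: newton_basis s k
   - newton_coef s c k.+1 *: newton_basis s k.+1)) => [|k _].
  rewrite -(big_mkord xpredT (fun k => newton_coef s c k *: newton_basis s k
   - newton_coef s c k.+1 *: newton_basis s k.+1)).
  under eq_bigr do rewrite -opprB.
  rewrite sumrN telescope_sumr // opprB.
  by rewrite /newton_coef /newton_basis !big_ord0 scale1r.
rewrite /newton_coef /newton_basis !big_ord_recr /=.
set a := \prod_(i < k) _; set w := \prod_(i < k) _.
have n0 : c - s`_k != 0 by apply/h/mem_nth.
rewrite -!mul_polyC !rmorphM /=.
have e : (c%:P - (s`_k)%:P) * ((c - s`_k)^-1)%:P = 1.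
  by rewrite -rmorphB -rmorphM mulfV.
transitivity (a%:P * w * ((c%:P - (s`_k)%:P) * ((c - s`_k)^-1)%:P)
   - a%:P * ((c - s`_k)^-1)%:P * (w * ('X - (s`_k)%:P))).
  ring.
by rewrite e mulr1.
Qed.

End Polynomials.

Section Hermite.
Variable C : numClosedFieldType.
Implicit Types (p q : {poly C}) (x : C).

(** In characteristic zero the derivatives at a root determine its order, because
    m! is invertible. *)
Lemma mup_ge_derivn q x k : q != 0 ->
  (forall j, (j < k)%N -> (derivn j q).[x] = 0) -> (k <= mup x q)%N.
Proof.
move=> q0 hd; rewrite leqNgt; apply/negP => /hd.
set m := mup x q.
have : ('X - x%:P) ^+ m %| q by rewrite -mup_geq.
case/dvdpP => u Eu; rewrite Eu derivn_XsubCM // eqxx.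
move/eqP; rewrite mulf_eq0 pnatr_eq0 (gtn_eqF (fact_gt0 _)) /= => ux.
have : ('X - x%:P) ^+ m.+1 %| q.
  by rewrite Eu exprS dvdp_mul2r ?expf_neq0 ?polyXsubC_eq0 // dvdp_XsubCl.
by rewrite -mup_geq // ltnn.
Qed.

Lemma monic_prod_XsubC q : q \is monic -> exists s : seq C, q = \prod_(x <- s) ('X - x%:P).
Proof.
move=> /monicP q1; have [s] := closed_field_poly_normal q.
by rewrite q1 scale1r => ->; exists s.
Qed.

(** Polynomials with the same Hermite data differ by a multiple of the minimal
    polynomial, because the base field is algebraically closed. *)
Lemma hermite_unique n (H : 'M[C]_n.+1) p q :
  (forall x j, (j < mup x (mxminpoly H))%N -> (derivn j p).[x] = (derivn j q).[x]) ->
  horner_mx H p = horner_mx H q.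
Proof.
move=> h; apply/eqP; rewrite -subr_eq0 -rmorphB; apply/eqP/mxminpoly_minP.
have [->|pq0] := eqVneq (p - q) 0; first exact: dvdp0.
have [s Es] := monic_prod_XsubC (mxminpoly_monic H).
rewrite Es; apply: dvd_prod_XsubC => // x.
apply: mup_ge_derivn => // j jx.
rewrite derivnB hornerD hornerN h ?subrr //.
by rewrite Es mu_prod_XsubC.
Qed.

End Hermite.

(** * Matrix functions as integrals of resolvents *)
Section MatrixFunction.
Variable R : realType.
Implicit Type (z : R[i]).

Lemma matfun_eq n (f : R[i] -> R[i]) (H F : 'M[R[i]]_n.+1) :
  is_matfun f H F -> matfun f H = F.
Proof.
move=> hF; rewrite /matfun; case: xgetP => [G _ [p hp ->]|/(_ F)]; last by [].
by case: hF => q hq ->; apply: hermite_unique => x j jx; rewrite hp // hq.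
Qed.

Lemma spectrum_minpoly n (H : 'M[R[i]]_n.+1) s : spectrum_off_cut H ->
  mxminpoly H = \prod_(x <- s) ('X - x%:P) -> forall x, x \in s -> ~~ (x <= 0).
Proof.
move=> hH Es x xs; apply: hH; rewrite eigenvalue_root_min Es.
by rewrite root_prod_XsubC.
Qed.

(** At the roots of the minimal polynomial the remainder term of the Newton
    identity vanishes when evaluated at H. *)
Lemma newton_resolvent n (H : 'M[R[i]]_n.+1) (s : seq R[i]) (c : R[i]) :
  mxminpoly H = \prod_(x <- s) ('X - x%:P) -> (forall x, x \in s -> c - x != 0) ->
  invmx (c%:M - H) = horner_mx H (\sum_(k < size s) newton_coef s c k.+1 *: newton_basis s k).
Proof.
move=> Es hc; set P := \sum_(k < _) _.
have E : (c%:M - H) *m horner_mx H P = 1%:M.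
  have := congr1 (horner_mx H) (newton_identity hc).
  rewrite rmorphM [X in X * _ = _]rmorphB /= horner_mx_C horner_mx_X.
  rewrite [X in _ = X]rmorphB /= rmorph1 linearZ /=.
  have -> : newton_basis s (size s) = mxminpoly H.
    by rewrite Es /newton_basis (big_nth 0) big_mkord.
  by rewrite mx_root_minpoly scaler0 subr0.
have [U _] := mulmx1_unit E.
by rewrite -[RHS]mul1mx -(mulVmx U) -mulmxA E mulmx1.
Qed.

Variables (g : R -> R) (rho : R -> R[i]).
Hypotheses (gS : stieltjes_density g) (trho : tame 0 rho).

Lemma tame_newton_coef (s : seq R[i]) k : (forall x, x \in s -> ~~ (x <= 0)) ->
  (k < size s)%N -> tame 1 (fun t : R => newton_coef s t%:C k.+1).
Proof.
move=> hs; rewrite /newton_coef; elim: k => [|k IH] ks.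
  under eq_fun do rewrite big_ord1.
  by apply/tame_resolvent/hs/mem_nth.
under eq_fun do rewrite big_ord_recr.
apply: (@tameW _ _ (1 + 1)) => //; apply: tameM; first by apply: IH; exact: ltnW.
by apply/tame_resolvent/hs/mem_nth.
Qed.

Lemma tame_invmx n (H : 'M[R[i]]_n.+1) a b : spectrum_off_cut H ->
  tame 1 (fun t : R => invmx ((t%:C)%:M - H) a b).
Proof.
move=> hH; have [s Es] := monic_prod_XsubC (mxminpoly_monic H).
have hs := spectrum_minpoly hH Es.
pose T t := \sum_(k < size s) horner_mx H (newton_basis s k) a b * newton_coef s t%:C k.+1.
apply: (@eq_tame _ _ T) => [t t0|]; last first.
  by apply: tame_sum => k; apply/tameZ/tame_newton_coef.
rewrite (newton_resolvent Es) => [|x xs]; last exact: off_cut_sub (hs x xs) t0.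
rewrite linear_sum summxE; apply: eq_bigr => k _.
by rewrite linearZ mxE mulrC.
Qed.

(** The polynomial that defines the matrix function is the integral over t of
    the Newton interpolants of 1 / (t - x). It has the right Hermite data: by
    Leibniz's rule, applied to the Newton identity, the derivatives of an
    interpolant at an eigenvalue x are j! / (t - x)^(j+1), and these integrate
    to the derivatives of the transform. Its value at H is the integral of the
    values of the interpolants, which are the resolvents. *)
Lemma matfun_stieltjes n (H : 'M[R[i]]_n.+1) : spectrum_off_cut H ->
  matfun (stieltjes (fun t => (g t)%:C * rho t)) H =
  \matrix_(a, b) stint g (fun t => rho t * invmx ((t%:C)%:M - H) a b).
Proof.
move=> hH; have [s Es] := monic_prod_XsubC (mxminpoly_monic H).
have hs := spectrum_minpoly hH Es.
have tc (k : 'I_(size s)) : tame 1 (fun t : R => rho t * newton_coef s t%:C k.+1).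
  by apply: (@tameW _ _ (0 + 1)) => //; apply: tameM trho _; exact: tame_newton_coef.
pose p := \sum_(k < size s)
  stint g (fun t : R => rho t * newton_coef s t%:C k.+1) *: newton_basis s k.
apply: matfun_eq; exists p; last first.
  rewrite linear_sum; apply/matrixP => a b; rewrite mxE summxE.
  pose T t := \sum_(k < size s)
    horner_mx H (newton_basis s k) a b * (rho t * newton_coef s t%:C k.+1).
  rewrite (@eq_stint _ g _ T) => [|t t0]; last first.
    rewrite (newton_resolvent Es) => [|x xs]; last exact: off_cut_sub (hs x xs) t0.
    rewrite linear_sum summxE mulr_sumr; apply: eq_bigr => k _.
    by rewrite linearZ mxE; ring.
  rewrite stint_sum //; last by move=> k; exact: tameZ.
  by apply: eq_bigr => k _; rewrite linearZ mxE stintZ // mulrC.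
move=> x j jx.
have xs : x \in s.
  by rewrite -has_pred1 has_count; move: jx; rewrite Es mu_prod_XsubC; apply: leq_ltn_trans.
have hx := hs x xs.
rewrite (derive1n_Psi gS trho j hx); last first.
  by move=> w _; apply: eq_cint => t _; rewrite expr1 mulrA.
rewrite /Psi -stintZ //; last exact: tame_Psi.
pose T t := \sum_(k < size s)
  (derivn j (newton_basis s k)).[x] * (rho t * newton_coef s t%:C k.+1).
transitivity (stint g T).
  rewrite /T stint_sum //; last by move=> k; exact: tameZ.
  rewrite /p linear_sum horner_sum; apply: eq_bigr => k _.
  by rewrite linearZ hornerZ stintZ // mulrC.
apply: eq_stint => t t0.
have nz y : y \in s -> t%:C - y != 0 by move=> /hs hy; exact: off_cut_sub hy t0.
pose P := \sum_(k < size s) newton_coef s t%:C k.+1 *: newton_basis s k.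
have -> : T t = rho t * (derivn j P).[x].
  rewrite /T /P linear_sum horner_sum mulr_sumr; apply: eq_bigr => k _.
  by rewrite linearZ hornerZ; ring.
rewrite [RHS]mulrCA; congr (rho t * _).
have Pid := newton_identity nz.
have Em : newton_basis s (size s) = mxminpoly H.
  by rewrite Es /newton_basis [in RHS](big_nth 0) big_mkord.
rewrite Em -/P in Pid.
have tx := nz x xs.
have dmu i : (i <= j)%N -> (derivn i (mxminpoly H)).[x] = 0.
  move=> ij; have : ('X - x%:P) ^+ j.+1 %| mxminpoly H.
    by rewrite -mup_geq // monic_neq0 ?mxminpoly_monic.
  case/dvdpP => u ->; rewrite derivn_XsubCM; last exact: leqW.
  by rewrite ltn_eqF.
move: {jx} dmu; elim: (j) => [|i IH] dmu.
  rewrite derivn0 fact0 mul1r expr1; apply: (mulfI tx); rewrite mulfV //.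
  have := congr1 (horner^~ x) Pid; rewrite /= hornerM hornerD hornerC hornerN hornerX => ->.
  have := dmu 0%N (leqnn _); rewrite derivn0 => mu0.
  by rewrite hornerD hornerN hornerZ mu0 mulr0 subr0 hornerC.
apply: (mulfI tx).
have := congr1 (fun q => (derivn i.+1 q).[x]) Pid.
rewrite [X in _ = X.[x] -> _]derivnB [X in _ = X -> _]hornerD hornerN derivnZ hornerZ dmu //.
have d1 : derivn i.+1 (1 : {poly R[i]}) = 0 by rewrite -polyC1 derivnC.
rewrite mulr0 subr0 d1 horner0 derivn_linear_mul hornerD hornerN.
rewrite hornerM hornerMn hornerD hornerN hornerC hornerX.
rewrite IH => [/eqP|k ki]; last by apply: dmu; exact: leqW.
rewrite subr_eq add0r => /eqP ->.
by rewrite [_^-1 ^+ i.+2]exprS [RHS]mulrCA mulVKf // factS natrM -mulr_natl mulrA.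
Qed.

End MatrixFunction.

(** * Arnoldi-like decompositions and shifted systems *)
Section Decompositions.
Variables (R : realType) (n : nat).
Local Notation C := (R[i]).
Variable A : 'M[C]_n.+1.
Implicit Types (v x : 'cV[C]_n.+1) (D : decomp R n).

Definition arnoldi_rel D : Prop :=
  A *m basis D = basis D *m hess D + subdiag D *: (nextv D *m delta_mx 0 ord_max).

Lemma arnoldi_apply D (c : 'cV_(prelen D).+1) : arnoldi_rel D ->
  A *m (basis D *m c) =
  basis D *m (hess D *m c) + (subdiag D * c ord_max 0) *: nextv D.
Proof.
move=> h; rewrite mulmxA h mulmxDl -mulmxA -scalemxAl -mulmxA -scalerA.
congr (_ + _ *: _); rewrite -rowE; apply/matrixP => i j.
by rewrite !mxE big_ord1 !mxE !ord1 mulrC.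
Qed.

Definition in_range m (B : 'M[C]_(n.+1, m)) x := exists c : 'cV_m, x = B *m c.

Lemma in_rangeP m (B : 'M[C]_(n.+1, m)) x : (x^T <= B^T)%MS <-> in_range B x.
Proof.
split=> [/submxP[c hc]|[c ->]].
  by exists c^T; apply: trmx_inj; rewrite trmx_mul trmxK.
by rewrite trmx_mul submxMl.
Qed.

Lemma basis_inj m (B : 'M[C]_(n.+1, m)) (c : 'cV_m) :
  \rank B = m -> B *m c = 0 -> c = 0.
Proof.
move=> hB h; apply: trmx_inj; rewrite trmx0.
have : row_free B^T by rewrite /row_free mxrank_tr hB.
by move/row_free_inj => inj; apply: (inj 1%N); rewrite mul0mx -trmx_mul h trmx0.
Qed.

Lemma krylov_col v j (l : 'I_j) : col l (krylov A v j) = A ^+ l *m v.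
Proof. by apply/matrixP => i k; rewrite !mxE !ord1. Qed.

Lemma krylov_scale v (s : C) j : krylov A (s *: v) j = s *: krylov A v j.
Proof. by apply/matrixP => i k; rewrite [LHS]mxE -scalemxAr [LHS]mxE [RHS]mxE [in RHS]mxE. Qed.

Lemma cols_in_range p m (B : 'M[C]_(n.+1, m)) (K : 'M[C]_(n.+1, p)) :
  (forall l, in_range B (col l K)) -> exists X, K = B *m X.
Proof.
move=> h; have : (K^T <= B^T)%MS.
  by apply/row_subP => l; rewrite -tr_col; apply/in_rangeP.
by case/submxP => X hX; exists X^T; apply: trmx_inj; rewrite trmx_mul trmxK.
Qed.

(** The absence of breakdown in the next step is part of this notion: it makes
    the next vector linearly independent of the basis. *)
Definition extendable v D := arnoldi_like A v D /\
  \rank (krylov A v (mlen D).+1) = (mlen D).+1.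

Lemma arnoldi_rel_stable D x : arnoldi_rel D -> in_range (basis D) (subdiag D *: nextv D) ->
  in_range (basis D) x -> in_range (basis D) (A *m x).
Proof.
move=> h [e he] [d ->]; rewrite arnoldi_apply // mulrC -scalerA he.
by exists (hess D *m d + d ord_max 0 *: e); rewrite mulmxDr scalemxAr.
Qed.

(** Otherwise A would map the range of the basis into itself, and the next
    Krylov space would not be larger. *)
Lemma extendable_notin v D : extendable v D ->
  ~ in_range (basis D) (subdiag D *: nextv D).
Proof.
move=> [[hrel _ hB _ hv] hrank] hin.
have hpow l : in_range (basis D) (A ^+ l *m v).
  elim: l => [|l IH].
    rewrite expr0 mul1mx hv; exists (beta D *: delta_mx ord0 0).
    by rewrite -scalemxAr -colE.
  by rewrite exprS -mulmxE -mulmxA; apply: arnoldi_rel_stable.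
have [X hX] : exists X, krylov A v (mlen D).+1 = basis D *m X.
  by apply: cols_in_range => l; rewrite krylov_col.
by have := mulmx_max_rank (basis D) X; rewrite -hX hrank ltnn.
Qed.

Lemma extendable_subdiag v D : extendable v D -> subdiag D != 0.
Proof.
move=> /extendable_notin h; apply/eqP => h0; apply: h.
by exists 0; rewrite h0 scale0r mulmx0.
Qed.

Lemma extendable_indep v D : extendable v D ->
  forall (c : 'cV_(prelen D).+1) (a : C),
  basis D *m c + a *: nextv D = 0 -> c = 0 /\ a = 0.
Proof.
move=> hD c a; have [[_ _ hB _ _] _] := hD.
have [->|a0] := eqVneq a 0.
  by rewrite scale0r addr0 => /(basis_inj hB).
move/eqP; rewrite addrC addr_eq0 => /eqP/(congr1 (fun x => (subdiag D * a^-1) *: x)).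
rewrite scalerA mulfVK // => h; exfalso; apply: (extendable_notin hD).
by exists (subdiag D * a^-1 *: - c); rewrite h -mulmxN -scalemxAr.
Qed.

Lemma extendable_range v D x : extendable v D ->
  in_range (basis D) x <-> in_range (krylov A v (mlen D)) x.
Proof.
move=> [[_ _ _ hK _] _]; by rewrite -!in_rangeP hK.
Qed.

Lemma range_start v D : v = beta D *: col ord0 (basis D) -> in_range (basis D) v.
Proof.
move=> hv; exists (beta D *: delta_mx ord0 0).
by rewrite -scalemxAr -colE.
Qed.

Lemma arnoldi_rel_nextv D : arnoldi_rel D -> subdiag D != 0 ->
  exists x y, [/\ in_range (basis D) x, in_range (basis D) y & nextv D = A *m x + y].
Proof.
move=> h h0; pose e : 'cV[C]_(prelen D).+1 := delta_mx ord_max 0.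
have := arnoldi_apply e h; rewrite mxE !eqxx mulr1 => E.
exists (basis D *m ((subdiag D)^-1 *: e)), (basis D *m (- (subdiag D)^-1 *: (hess D *m e))).
split; [by eexists; reflexivity|by eexists; reflexivity|].
by rewrite -!scalemxAr E scaleNr scalerDr scalerA mulVf // scale1r addrAC subrr add0r.
Qed.

(** Removing the first row and the last column of a Hessenberg matrix leaves a
    triangular one, whose determinant is the product of the subdiagonal. *)
Lemma corner_invmx m (M : 'M[C]_m.+1) : (forall i j : 'I_m.+1, (j.+1 < i)%N -> M i j = 0) ->
  M \in unitmx ->
  invmx M ord_max ord0 =
    \prod_(j < m) (- M (lift ord0 j) (widen_ord (leqnSn _) j)) / \det M.
Proof.
move=> hM uM; rewrite /invmx uM !mxE /cofactor /= add0n mulrC; congr (_ / _).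
rewrite prodrN card_ord; congr (_ * _).
rewrite -det_tr det_trig.
  apply: eq_bigr => j _; rewrite !mxE; congr (M _ _).
  by apply: val_inj; exact: lift_max.
apply/is_trig_mxP => i j ij; rewrite !mxE; apply: hM.
by rewrite lift0 lift_max.
Qed.

(** The Krylov approximation to the solution of (t - A) x = v. *)
Definition shift_solve D (t : C) : 'cV[C]_n.+1 :=
  basis D *m invmx (t%:M - hess D) *m (beta D *: delta_mx ord0 0).

(** The residual is a multiple of the next vector for every shift t, with the
    factor that defines the kernel of the next cycle. This is what makes
    restarts possible. *)
Lemma shift_residual v D (t : C) : arnoldi_like A v D -> t%:M - hess D \in unitmx ->
  v - (t%:M - A) *m shift_solve D t =
  (gamma D * beta D / \det (t%:M - hess D)) *: nextv D.
Proof.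
move=> [hrel hess0 _ _ hv] ut; rewrite /shift_solve -mulmxA.
set c := invmx _ *m _.
have hc : (t%:M - hess D) *m c = beta D *: delta_mx ord0 0.
  by rewrite mulmxA mulmxV // mul1mx.
have cmax : c ord_max 0 = beta D * invmx (t%:M - hess D) ord_max ord0.
  by rewrite /c -scalemxAr mxE -colE mxE.
have Ht : hess D *m c = t *: c - beta D *: delta_mx ord0 0.
  by rewrite -hc mulmxBl mul_scalar_mx opprB addrC subrK.
have -> : (t%:M - A) *m (basis D *m c) = v - (subdiag D * c ord_max 0) *: nextv D.
  rewrite mulmxBl arnoldi_apply // mul_scalar_mx Ht mulmxBr -!scalemxAr -colE -hv.
  by rewrite !opprD opprK addrA addrA subrr add0r.
rewrite opprB addrC subrK.
rewrite cmax corner_invmx //; last first.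
    move=> i j ij; rewrite !mxE hess0 // subr0.
    rewrite (_ : (i == j) = false) ?mulr0n //.
    by apply/eqP => e; move: ij; rewrite e ltnNge leqnSn.
  rewrite /gamma; congr (_ *: _).
  rewrite (eq_bigr (fun j => hess D (lift ord0 j) (widen_ord (leqnSn _) j))).
    by ring.
  move=> j _; rewrite !mxE opprB; rewrite (_ : (_ == _) = false) ?mulr0n ?subr0 //.
  by apply/eqP => /(congr1 val) /=; rewrite /bump /= => /eqP; rewrite add1n gtn_eqF.
Qed.

End Decompositions.

(** * Spectra, shifted determinants and correction terms *)
Section Spectra.
Variable R : realType.
Local Notation C := (R[i]).

Lemma eigenvalue_unit m (H : 'M[C]_m) (a : C) :
  eigenvalue H a = (a%:M - H \notin unitmx).
Proof.
rewrite /eigenvalue /eigenspace kermx_eq0 -row_free_unit /row_free.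
by rewrite -[a%:M - H]opprB mxrank_opp.
Qed.

Lemma unitmx_inj m (M : 'M[C]_m) : (forall c : 'cV_m, M *m c = 0 -> c = 0) ->
  M \in unitmx.
Proof.
move=> h; rewrite -unitmx_tr -row_free_unit -kermx_eq0; apply: contraT.
case/rowV0Pn => u /sub_kermxP hu; rewrite -trmx_eq0 => /eqP; case.
by apply: h; apply: trmx_inj; rewrite trmx_mul trmxK hu trmx0.
Qed.

Lemma eigenvalue_colP m (H : 'M[C]_m) (a : C) :
  eigenvalue H a <-> exists2 c : 'cV_m, (a%:M - H) *m c = 0 & c != 0.
Proof.
rewrite eigenvalue_unit; split=> [h|[c hc c0]]; last first.
  apply/negP => u; move/negP: c0; apply.
  by rewrite -[c]mul1mx -(mulVmx u) -mulmxA hc mulmx0.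
apply: contrapT => hn; move/negP: h; apply; apply: unitmx_inj => c hc.
by apply: contrapT => /eqP c0; apply: hn; exists c.
Qed.

Lemma det_shift_roots m (H : 'M[C]_m) : exists2 s : seq C,
  forall c, \det (c%:M - H) = \prod_(x <- s) (c - x) &
  forall x, (x \in s) = eigenvalue H x.
Proof.
have [s Es] := monic_prod_XsubC (char_poly_monic H).
have hd c : \det (c%:M - H) = \prod_(x <- s) (c - x).
  transitivity (char_poly H).[c].
    rewrite /char_poly -[_.[c]]/(horner_eval c _) -det_map_mx; congr (\det _).
    apply/matrixP => i j; rewrite !mxE rmorphB rmorphMn /=.
    by rewrite /horner_eval hornerX hornerC.
  rewrite Es horner_prod; apply: eq_bigr => x _.
  by rewrite hornerXsubC.
exists s => // x; rewrite eigenvalue_unit unitmxE unitfE negbK hd.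
rewrite prodf_seq_eq0; apply/idP/hasP => [xs|[y ys]]; first by exists x; rewrite ?subrr ?eqxx.
by rewrite subr_eq0 => /eqP ->.
Qed.

Lemma shift_unit m (H : 'M[C]_m) (t : R) : spectrum_off_cut H -> t <= 0 ->
  (t%:C)%:M - H \in unitmx.
Proof.
move=> hH t0; apply: contraT; rewrite -eigenvalue_unit => /hH.
by rewrite lecR t0.
Qed.

Lemma tame_inv_det m (H : 'M[C]_m) : spectrum_off_cut H ->
  tame 0 (fun t : R => (\det ((t%:C)%:M - H))^-1).
Proof.
move=> hH; have [s hd hs] := det_shift_roots H.
apply: (@eq_tame _ _ (fun t : R => \prod_(x <- s) (t%:C - x)^-1)) => [t _|].
  by rewrite hd prodfV.
have {hd} : forall x, x \in s -> ~~ (x <= 0) by move=> x; rewrite hs; exact: hH.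
elim: s {hs} => [|x s IH] hs.
  by under eq_fun do rewrite big_nil; exact: tame_cst.
under eq_fun do rewrite big_cons.
apply: (@tameW _ _ (1 + 0)) => //; apply: tameM.
  by apply/tame_resolvent/hs; rewrite mem_head.
by apply: IH => y ys; apply: hs; rewrite in_cons ys orbT.
Qed.

End Spectra.

Section Corrections.
Variables (R : realType) (n : nat).
Local Notation C := (R[i]).
Variable g : R -> R.
Hypothesis gS : stieltjes_density g.
Implicit Type D : nat -> decomp R n.

(** The factor by which the k-th kernel differs from the given density. *)
Fixpoint rho D (k : nat) (t : R) : C :=
  if k is l.+1 then gamma (D l) * beta (D l) * rho D l t / phi (D l) t else 1.

Lemma gkE D k t : gk g D k t = (g t)%:C * rho D k t.
Proof. by elim: k => [|k IH] /=; rewrite ?mulr1 // IH; ring. Qed.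

Lemma tame_rho D k : matfuns_defined D -> tame 0 (rho D k).
Proof.
move=> hD; elim: k => [|k IH] /=; first exact: tame_cst.
apply: (@tameM _ 0 0); last exact: tame_inv_det.
exact: tameZ.
Qed.

Lemma correction_entry D k i : matfuns_defined D ->
  correction g D k i 0 = stint g (fun t => rho D k t * shift_solve (D k) t%:C i 0).
Proof.
move=> hD; rewrite /correction /err.
have -> : gk g D k = fun t => (g t)%:C * rho D k t by apply/funext => t; exact: gkE.
rewrite matfun_stieltjes //; last exact: tame_rho.
rewrite -scalemxAr -colE !mxE.
pose T (t : R) := \sum_l (beta (D k) * basis (D k) i l) *
  (rho D k t * invmx ((t%:C)%:M - hess (D k)) l ord0).
rewrite [RHS](@eq_stint _ g _ T) => [|t _]; last first.
  rewrite /T /shift_solve -scalemxAr -colE !mxE !mulr_sumr.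
  by apply: eq_bigr => l _; ring.
have tl l : tame 1 (fun t : R => rho D k t * invmx ((t%:C)%:M - hess (D k)) l ord0).
  by apply: (@tameM _ 0 1); [exact: tame_rho|exact: tame_invmx].
rewrite stint_sum //; last by move=> l; exact: tameZ.
rewrite mulr_sumr; apply: eq_bigr => l _.
by rewrite stintZ // mxE mulrA.
Qed.

End Corrections.

(** * Equivalence of restarted methods *)
Section Equivalence.
Variables (R : realType) (n : nat).
Local Notation C := (R[i]).
Variable A : 'M[C]_n.+1.

(** A shifted residual that lies in the line of the next vector has no component
    in the Krylov space. *)
Lemma kernel_shift v (D : decomp R n) (t mu : C) c : extendable A v D ->
  (t%:M - A) *m (basis D *m c) = mu *: nextv D -> (t%:M - hess D) *m c = 0.
Proof.
move=> hD; have [[hrel _ _ _ _] _] := hD.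
rewrite mulmxBl (arnoldi_apply _ hrel) => h.
have E : basis D *m ((t%:M - hess D) *m c) = (mu + subdiag D * c ord_max 0) *: nextv D.
  rewrite scalerDl -h mulmxBl mulmxBr !mul_scalar_mx -scalemxAr opprD addrA.
  by rewrite subrK.
apply: (proj1 (extendable_indep hD (a := - (mu + subdiag D * c ord_max 0)) _)).
by rewrite E scaleNr subrr.
Qed.

Lemma collinear_scalar (v : 'cV[C]_n.+1) (s r r' : C) : v != 0 ->
  r' *: (s *: v) = r *: v -> r' * s = r.
Proof.
move=> v0 /eqP; rewrite scalerA -subr_eq0 -scalerBl scaler_eq0 (negPf v0) orbF.
by rewrite subr_eq0 => /eqP.
Qed.

Lemma extendable_rank v (D : decomp R n) : extendable A v D ->
  \rank (krylov A v (mlen D)) = mlen D.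
Proof. by move=> [[_ _ hB hK _] _]; rewrite -mxrank_tr -hK mxrank_tr. Qed.

Lemma extendable_start_neq0 v (D : decomp R n) : extendable A v D -> v != 0.
Proof.
move=> [_ h]; apply/eqP => v0.
have : krylov A v (mlen D).+1 = 0 by rewrite v0 -(scale0r 0) krylov_scale scale0r.
by move=> h0; move: h; rewrite h0 mxrank0.
Qed.

(** This is the relation between the cycles of two equivalent methods: the
    bases, and the scaling of the vectors handed over, are free. *)
Definition collinear_cycles (v v' : 'cV[C]_n.+1) (D D' : decomp R n) (s s' : C) :=
  [/\ v' = s *: v, nextv D' = s' *: nextv D &
      forall x, in_range (basis D') x <-> in_range (basis D) x].

Lemma collinear_spectrum v v' D D' s s' (a : C) :
  extendable A v D -> extendable A v' D' -> collinear_cycles v v' D D' s s' ->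
  eigenvalue (hess D') a -> eigenvalue (hess D) a.
Proof.
move=> hD hD' [_ hn hr] /eigenvalue_colP[c hc c0].
have [[hrel' _ hB' _ _] _] := hD'.
have [d hd] : in_range (basis D) (basis D' *m c) by apply/hr; exists c.
apply/eigenvalue_colP; exists d; last first.
  apply: contraNneq c0 => d0; apply/eqP/(basis_inj hB').
  by rewrite hd d0 mulmx0.
apply: (kernel_shift (mu := - (subdiag D' * c ord_max 0) * s') hD).
rewrite -hd -scalerA -hn mulmxBl (arnoldi_apply _ hrel') mul_scalar_mx.
have -> : hess D' *m c = a *: c.
  by apply/eqP; rewrite eq_sym -subr_eq0 -mul_scalar_mx -mulmxBl hc.
by rewrite -scalemxAr opprD addrA subrr add0r scaleNr.
Qed.

(** The Krylov approximation is the only vector of the Krylov space whose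
    residual is a multiple of the next vector; this characterization does not
    mention a basis. *)
Lemma collinear_solve v v' D D' s s' (t : C) :
  extendable A v D -> extendable A v' D' -> collinear_cycles v v' D D' s s' ->
  t%:M - hess D \in unitmx -> t%:M - hess D' \in unitmx ->
  shift_solve D' t = s *: shift_solve D t.
Proof.
move=> hD hD' [hv hn hr] u u'.
have [[hl _] [hl' _]] := (hD, hD').
have R1 := shift_residual hl u; have R2 := shift_residual hl' u'.
have [d hd] : in_range (basis D) (shift_solve D' t).
  by apply/hr; eexists; rewrite /shift_solve -mulmxA.
pose c : 'cV[C]_(prelen D).+1 := invmx (t%:M - hess D) *m (beta D *: delta_mx ord0 0).
have E1 : shift_solve D t = basis D *m c by rewrite /shift_solve -mulmxA.
apply/eqP; rewrite -subr_eq0 hd E1 scalemxAr -mulmxBr; apply/eqP.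
have : (t%:M - hess D) *m (d - s *: c) = 0.
  apply: (kernel_shift (mu := s * (gamma D * beta D / \det (t%:M - hess D))
     - gamma D' * beta D' / \det (t%:M - hess D') * s') hD).
  rewrite mulmxBr -scalemxAr -E1 -hd mulmxBr -scalemxAr scalerBl
    -[(s * _) *: _]scalerA -[(_ * s') *: _]scalerA -hn -R1 -R2.
  by rewrite hv scalerBr opprB [RHS]addrC addrA subrK.
move=> h0; have -> : d - s *: c = 0; last by rewrite mulmx0.
by rewrite -[LHS]mul1mx -(mulVmx u) -mulmxA h0 mulmx0.
Qed.

Lemma collinear_extendable v v' D D' s : s != 0 -> v' = s *: v ->
  extendable A v D -> arnoldi_like A v' D' -> mlen D = mlen D' -> extendable A v' D'.
Proof.
move=> s0 -> [_ hr] h hl; split=> //.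
by rewrite -hl krylov_scale; apply: etrans hr; exact: mxrank_scale_nz.
Qed.

Lemma collinear_range v v' D D' s : s != 0 -> v' = s *: v ->
  extendable A v D -> extendable A v' D' -> mlen D = mlen D' ->
  forall x, in_range (basis D') x <-> in_range (basis D) x.
Proof.
move=> s0 hv hD hD' hl x.
rewrite (extendable_range x hD) (extendable_range x hD') -hl hv krylov_scale.
split=> -[c ->].
  by exists (s *: c); rewrite -scalemxAr -scalemxAl.
by exists (s^-1 *: c); rewrite -scalemxAr -scalemxAl scalerA mulVf // scale1r.
Qed.

(** Both next vectors lie in K + A K, whose dimension exceeds that of K by one.
    A homogeneous condition Q that no nonzero vector of K satisfies therefore
    determines them up to a scalar. *)
Lemma nextv_collinear v v' D D' p (Q : 'M[C]_(p, n.+1)) :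
  extendable A v D -> extendable A v' D' ->
  (forall x, in_range (basis D') x <-> in_range (basis D) x) ->
  (forall x, in_range (basis D) x -> Q *m x = 0 -> x = 0) ->
  Q *m nextv D = 0 -> Q *m nextv D' = 0 ->
  exists2 s', s' != 0 & nextv D' = s' *: nextv D.
Proof.
move=> hD hD' hr hQ Q1 Q2.
have [[hrel _ _ _ _] _] := hD; have [[hrel' _ _ _ _] _] := hD'.
have [x [y [/hr[c hc] /hr[d hd] hn]]] := arnoldi_rel_nextv hrel' (extendable_subdiag hD').
set s' := subdiag D * c ord_max 0.
have En : nextv D' = basis D *m (hess D *m c + d) + s' *: nextv D.
  by rewrite hn hc hd (arnoldi_apply _ hrel) mulmxDr addrAC.
have z0 : basis D *m (hess D *m c + d) = 0.
  apply: hQ; first by eexists.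
  by move: Q2; rewrite En mulmxDr -scalemxAr Q1 scaler0 addr0.
rewrite z0 add0r in En; exists s' => //.
apply/eqP => s0; apply: (extendable_notin hD').
by exists 0; rewrite En s0 scale0r scaler0 mulmx0.
Qed.

Variables (g : R -> R) (b : 'cV[C]_n.+1) (D D' : nat -> decomp R n).
Hypotheses (gS : stieltjes_density g).
Hypothesis hD : forall k, extendable A (start b D k) (D k).
(** The rank condition is a premise because it is known for the first run only;
    collinearity transfers it to the second. *)
Hypothesis hD' : forall k,
  \rank (krylov A (start b D' k) (mlen (D' k))) = mlen (D' k) ->
  arnoldi_like A (start b D' k) (D' k).
Hypothesis hlen : same_lengths D D'.
Hypothesis hnext : forall k, extendable A (start b D' k) (D' k) ->
  (forall x, in_range (basis (D' k)) x <-> in_range (basis (D k)) x) ->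
  exists2 s', s' != 0 & nextv (D' k) = s' *: nextv (D k).

(** Collinear next vectors are collinear starting vectors of the next cycle. *)
Lemma collinear_runs k : exists s s',
  [/\ s != 0, collinear_cycles (start b D k) (start b D' k) (D k) (D' k) s s' &
   extendable A (start b D' k) (D' k)].
Proof.
have step j s : s != 0 -> start b D' j = s *: start b D j ->
    exists2 s', s' != 0 & collinear_cycles (start b D j) (start b D' j) (D j) (D' j) s s' /\
   extendable A (start b D' j) (D' j).
  move=> s0 hs; have hl : arnoldi_like A (start b D' j) (D' j).
    by apply: hD'; rewrite -hlen hs krylov_scale mxrank_scale_nz // (extendable_rank (hD j)).
  have he := collinear_extendable s0 hs (hD j) hl (hlen j).
  have hr := collinear_range s0 hs (hD j) he (hlen j).
  by have [s' s'0 hs'] := hnext he hr; exists s'.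
suff [s s0 hs] : exists2 s, s != 0 & start b D' k = s *: start b D k.
  by have [s' _ [h1 h2]] := step _ _ s0 hs; exists s, s'.
elim: k => [|k [s s0 hs]]; first by exists 1; rewrite ?oner_eq0 ?scale1r.
by have [s' s'0 [[_ h _] _]] := step _ _ s0 hs; exists s'.
Qed.

Lemma collinear_matfuns : matfuns_defined D -> matfuns_defined D'.
Proof.
move=> hspec k a ha; have [s [s' [_ hc he]]] := collinear_runs k.
exact: hspec (collinear_spectrum (hD k) he hc ha).
Qed.

Lemma rhoS (E : nat -> decomp R n) k t : rho E k.+1 t = rho E k t *
  (gamma (E k) * beta (E k) / \det ((t%:C)%:M - hess (E k))).
Proof. by rewrite /= /phi; ring. Qed.

(** The scalings of the starting vectors and of the kernels compensate: what is
    invariant is the residual of each shifted system. *)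
Lemma same_residuals k t : matfuns_defined D -> t <= 0 ->
  rho D' k t *: start b D' k = rho D k t *: start b D k.
Proof.
move=> hspec t0; have hm' := collinear_matfuns hspec.
elim: k => [//|k IH].
have [s [s' [_ hc he]]] := collinear_runs k.
have [u u'] := (shift_unit (hspec k) t0, shift_unit (hm' k) t0).
have R1 := shift_residual (hD k).1 u; have R2 := shift_residual he.1 u'.
have [hv _ _] := hc.
have hr : rho D' k t * s = rho D k t.
  by apply: (collinear_scalar (extendable_start_neq0 (hD k))); rewrite -hv.
rewrite !rhoS -[LHS]scalerA -[RHS]scalerA -R1 -R2 (collinear_solve (hD k) he hc u u').
rewrite scalerBr IH [RHS]scalerBr.
by congr (_ - _); rewrite -scalemxAr scalerA hr.
Qed.

Lemma same_approx_collinear : matfuns_defined D -> same_approx g D D'.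
Proof.
move=> hspec; have hm' := collinear_matfuns hspec.
have hcor k : correction g D k = correction g D' k.
  apply/colP => i; rewrite !correction_entry //; apply: eq_stint => t t0.
  have [s [s' [s0 hc he]]] := collinear_runs k.
  have [u u'] := (shift_unit (hspec k) t0, shift_unit (hm' k) t0).
  rewrite (collinear_solve (hD k) he hc u u') [X in _ = _ * X]mxE mulrA; congr (_ * _).
  apply/esym/(collinear_scalar (extendable_start_neq0 (hD k))).
  by have [hv _ _] := hc; rewrite -hv same_residuals.
by elim=> [|k IH] /=; [exact: hcor | rewrite IH hcor].
Qed.

End Equivalence.

(** * The truncated Arnoldi process *)
Section Process.
Variables (R : realType) (n : nat).
Local Notation C := (R[i]).
Variable A : 'M[C]_n.+1.

(** The Hessenberg shape keeps A^l v in the span of the first l + 1 columns, so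
    the basis spans a space that contains the Krylov space; the rank condition
    gives equality. *)
Lemma arnoldi_like_intro (v : 'cV[C]_n.+1) (D : decomp R n) :
  arnoldi_rel A D ->
  (forall i j : 'I_(prelen D).+1, (j.+1 < i)%N -> hess D i j = 0) ->
  v = beta D *: col ord0 (basis D) ->
  \rank (krylov A v (mlen D)) = mlen D -> arnoldi_like A v D.
Proof.
move=> hrel hH hv hr.
have hpow l : (l < mlen D)%N -> exists2 c : 'cV_(prelen D).+1,
    A ^+ l *m v = basis D *m c & forall i : 'I_(prelen D).+1, (l < i)%N -> c i 0 = 0.
  elim: l => [|l IH] hl.
    exists (beta D *: delta_mx ord0 0).
      by rewrite expr0 mul1mx -scalemxAr -colE.
    move=> i i0; rewrite !mxE (_ : (i == ord0) = false) ?mulr0 //.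
    by apply/eqP => e; rewrite e in i0.
  have [c hc c0] := IH (ltnW hl).
  exists (hess D *m c).
    rewrite exprS -mulmxE -mulmxA hc (arnoldi_apply _ hrel) c0 //.
    by rewrite mulr0 scale0r addr0.
  move=> i hi; rewrite mxE big1 // => k _.
  have [kl|kl] := ltnP l k; first by rewrite c0 ?mulr0.
  by rewrite hH ?mul0r // (leq_ltn_trans _ hi).
have [X hX] : exists X, krylov A v (mlen D) = basis D *m X.
  apply: cols_in_range => l; rewrite krylov_col.
  by have [c hc _] := hpow l (ltn_ord l); exists c.
have uX : X \in unitmx.
  rewrite -row_free_unit /row_free eqn_leq rank_leq_row /=.
  by rewrite -[leqLHS]hr hX mxrankM_maxr.
have hB : basis D = krylov A v (mlen D) *m invmx X by rewrite hX mulmxK.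
split=> //.
- apply/eqP; rewrite eqn_leq rank_leq_col /=.
  by rewrite -[leqLHS]hr hX mxrankM_maxl.
- rewrite hX trmx_mul; apply: eqmx_sym; apply: eqmxMfull.
  by rewrite row_full_unit unitmx_tr.
Qed.

Lemma cdotBr (x y z : 'cV[C]_n.+1) (a : C) :
  cdot x (y - a *: z) = cdot x y - a * cdot x z.
Proof. by rewrite /cdot mulmxBr -scalemxAr !mxE. Qed.

Lemma eq_mgs (q q' : nat -> 'cV[C]_n.+1) w s :
  {in s, q =1 q'} -> mgs q w s = mgs q' w s.
Proof.
rewrite /mgs; elim: s w => [//|i s IH] w h /=.
rewrite h ?mem_head // IH // => j js; apply: h.
by rewrite in_cons js orbT.
Qed.

Lemma iota_rcons a k : iota a k.+1 = rcons (iota a k) (a + k)%N.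
Proof. by rewrite -addn1 iotaD cats1. Qed.

Lemma mgs_rcons (q : nat -> 'cV[C]_n.+1) w s i :
  mgs q w (rcons s i) = mgs q w s - cdot (q i) (mgs q w s) *: q i.
Proof. by rewrite /mgs foldl_rcons. Qed.

Lemma mgs_sum (q : nat -> 'cV[C]_n.+1) w a b : mgs q w (iota a (b - a)) =
  w - \sum_(a <= i < b) cdot (q i) (mgs q w (iota a (i - a))) *: q i.
Proof.
elim: b => [|b IH]; first by rewrite sub0n big_geq // subr0.
have [ab|ba] := leqP a b; last first.
  by rewrite (eqP ba) big_geq // subr0.
rewrite big_nat_recr //= subSn // iota_rcons mgs_rcons.
by rewrite subnKC // {1}IH opprD addrA.
Qed.

(** Zero vectors are allowed because a vanishing vector is normalized to zero:
    orthogonality then needs no assumption on breakdowns. *)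
Lemma mgs_orthogonal (q : nat -> 'cV[C]_n.+1) w k :
  (forall i j, (i < k)%N -> (j < k)%N -> i != j -> cdot (q i) (q j) = 0) ->
  (forall i, (i < k)%N -> cdot (q i) (q i) = 1 \/ q i = 0) ->
  forall i, (i < k)%N -> cdot (q i) (mgs q w (iota 0 k)) = 0.
Proof.
elim: k => [//|k IH] ho hn i; rewrite ltnS leq_eqVlt.
rewrite iota_rcons mgs_rcons add0n cdotBr.
set u := mgs _ _ _.
case/orP=> [/eqP ->|ik].
  case: (hn k) => // [->|->]; first by rewrite mulr1 subrr.
  by rewrite /cdot raddf0 map_mx0 !mul0mx mxE mul0r subr0.
rewrite IH ?ho ?mulr0 ?subr0 //; try by rewrite ?ltn_eqF // ltnW.
- by move=> j l hj hl; apply: ho; exact: ltnW.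
- by move=> j hj; apply: hn; exact: ltnW.
Qed.

Variables (lo : nat -> nat) (v : 'cV[C]_n.+1).
Local Notation q := (process_vec A lo v).

Lemma size_process_seq k : size (process_seq A lo v k) = k.+1.
Proof. by elim: k => [//|k IH] /=; rewrite size_rcons IH. Qed.

Lemma nth_process_seq k j : (j <= k)%N -> nth 0 (process_seq A lo v k) j = q j.
Proof.
elim: k => [|k IH]; first by rewrite leqn0 => /eqP ->.
rewrite leq_eqVlt => /orP[/eqP -> //|]; rewrite ltnS => jk.
by rewrite /= nth_rcons size_process_seq ltnS jk IH.
Qed.

Lemma process_vecS j : q j.+1 =
  (vnorm (process_step A lo q j))%:C^-1 *: process_step A lo q j.
Proof.
rewrite /process_vec /= nth_rcons size_process_seq ltnn eqxx.
have -> : process_step A lo (nth 0 (process_seq A lo v j)) j =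
          process_step A lo q j; last by [].
rewrite /process_step nth_process_seq //; apply: eq_mgs => i.
rewrite mem_iota => /andP[li]; have [lj|lj] := leqP (lo j) j.+1.
  by rewrite subnKC // ltnS => ij; rewrite nth_process_seq.
move: (ltnW lj); rewrite -subn_eq0 => /eqP ->.
by rewrite addn0 ltnNge li.
Qed.

Lemma vnorm_eq0 m (x : 'cV[C]_m) : vnorm x = 0 -> x = 0.
Proof.
move/eqP; rewrite /vnorm sqrtr_eq0 => h.
have : \sum_i normc (x i 0) ^+ 2 == 0.
  by rewrite eq_le h sumr_ge0 // => i _; rewrite sqr_ge0.
rewrite psumr_eq0 => [/allP h0|i _]; last by rewrite sqr_ge0.
apply/colP => i; rewrite mxE.
by have := h0 i (mem_index_enum _); rewrite /= sqrf_eq0 normc_eq0 => /eqP.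
Qed.

Lemma vnormK m (x : 'cV[C]_m) : (vnorm x)%:C *: ((vnorm x)%:C^-1 *: x) = x.
Proof.
have [h|h] := eqVneq (vnorm x) 0.
  by rewrite (vnorm_eq0 h) !scaler0.
rewrite scalerA mulfV ?scale1r //.
by apply: contraNneq h => /(congr1 (@complex.Re R)) /= ->.
Qed.

(** The identity holds even if the new vector vanishes, since then its
    coefficient vanishes too. *)
Lemma process_recurrence j :
  A *m q j = \sum_(i < j.+2) process_coef A lo v i j *: q i.
Proof.
rewrite big_ord_recr /= {2}/process_coef eqxx process_vecS vnormK.
rewrite {1}/process_step mgs_sum.
rewrite (_ : \sum_(i < j.+1) _ = \sum_(lo j <= i < j.+1)
   cdot (q i) (mgs q (A *m q j) (iota (lo j) (i - lo j))) *: q i).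
  by rewrite addrC subrK.
rewrite -(big_mkord xpredT (fun i => process_coef A lo v i j *: q i)).
rewrite [RHS](big_nat_widenl _ 0%N) // [RHS]big_mkcond /=.
apply: eq_big_nat => i /andP[_ ij].
have ij2 : (i <= j)%N := ij.
rewrite /process_coef ltn_eqF // ij2 andbT.
by case: ifP; rewrite ?scale0r.
Qed.

Lemma process_coef_hess i j : (j.+1 < i)%N -> process_coef A lo v i j = 0.
Proof.
move=> h; rewrite /process_coef gtn_eqF //.
by rewrite [(i <= j)%N]leqNgt (ltn_trans (ltnSn j)) // andbF.
Qed.

Lemma process_rel p : arnoldi_rel A (process_decomp A lo v p).
Proof.
apply/matrixP => i j; rewrite /= !mxE.
have -> : \sum_k A i k * process_basis A lo v p.+1 k j = (A *m q j) i 0.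
  by rewrite mxE; apply: eq_bigr => k _; rewrite mxE.
rewrite process_recurrence.
have -> : \sum_(l < j.+2) process_coef A lo v l j *: q l =
   \sum_(l < p.+2) process_coef A lo v l j *: q l.
  have jp : (j.+2 <= p.+2)%N by rewrite ltnS ltn_ord.
  rewrite (big_ord_widen _ (fun l => process_coef A lo v l j *: q l) jp).
  rewrite big_mkcond /=; apply: eq_bigr => l _; case: ltnP => // h.
  by rewrite process_coef_hess ?scale0r.
rewrite big_ord_recr /= mxE summxE; congr (_ + _).
  by apply: eq_bigr => l _; rewrite !mxE mulrC.
rewrite big_ord1 !mxE /=.
have [->|jp] := eqVneq j ord_max; first by rewrite mulr1.
rewrite /= !mulr0 process_coef_hess ?mul0r // ltnS ltn_neqAle -ltnS ltn_ord andbT.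
by apply: contraNneq jp => h; apply/eqP/val_inj.
Qed.

Lemma process_arnoldi_like p : \rank (krylov A v p.+1) = p.+1 ->
  arnoldi_like A v (process_decomp A lo v p).
Proof.
move=> hr; apply: arnoldi_like_intro => //; first exact: process_rel.
  by move=> i j ij; rewrite mxE process_coef_hess.
rewrite /= -[LHS]vnormK; congr (_ *: _).
by apply/colP => i; rewrite !mxE.
Qed.

End Process.

(** * Orthogonality and the two equivalences *)
Section InnerProduct.
Variables (R : realType).
Local Notation C := (R[i]).

Lemma cdotE m (x y : 'cV[C]_m) : cdot x y = \sum_i (x i 0)^*%R * y i 0.
Proof. by rewrite /cdot mxE; apply: eq_bigr => i _; rewrite !mxE. Qed.

Lemma cdot_conj m (x y : 'cV[C]_m) : cdot x y = (cdot y x)^*%R.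
Proof.
rewrite !cdotE rmorph_sum; apply: eq_bigr => i _.
by rewrite rmorphM /= conjCK mulrC.
Qed.

Lemma conj_normc (z : C) : z^*%R * z = (normc z ^+ 2)%:C.
Proof. by rewrite mulrC -normCK normr_normc -rmorphXn. Qed.

Lemma cdotxx m (x : 'cV[C]_m) : cdot x x = (vnorm x ^+ 2)%:C.
Proof.
rewrite /vnorm sqr_sqrtr; last by apply: sumr_ge0 => i _; rewrite sqr_ge0.
rewrite cdotE rmorph_sum; apply: eq_bigr => i _.
by rewrite conj_normc.
Qed.

Lemma cdot_mulmx m p (B : 'M[C]_(m, p)) (x : 'cV_p) (y : 'cV_m) :
  cdot (B *m x) y = cdot x (B^t* *m y).
Proof.
rewrite /cdot; congr (_ 0 0).
by rewrite trmx_mul map_mxM mulmxA.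
Qed.

Lemma orthogonalP n p (B : 'M[C]_(n.+1, p)) (x : 'cV_n.+1) :
  orthogonal_to B x <-> forall y, in_range B y -> cdot y x = 0.
Proof.
split=> [h _ [c ->]|h]; first by rewrite cdot_mulmx h /cdot mulmx0 mxE.
apply/colP => i; rewrite [RHS]mxE.
have := h (B *m delta_mx i 0) (ex_intro _ _ erefl).
rewrite cdot_mulmx cdotE (bigD1 i) //= big1 => [|j ji].
  by rewrite !mxE !eqxx rmorph1 mul1r addr0.
by rewrite mxE (negPf ji) rmorph0 mul0r.
Qed.

Lemma cdotZr m (x y : 'cV[C]_m) a : cdot x (a *: y) = a * cdot x y.
Proof. by rewrite /cdot -scalemxAr mxE. Qed.

Lemma vnormZ m (x : 'cV[C]_m) a : vnorm (a *: x) = normc a * vnorm x.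
Proof.
rewrite /vnorm -[normc a]ger0_norm ?normc_ge0 // -sqrtr_sqr -sqrtrM ?sqr_ge0 //.
congr (Num.sqrt _); rewrite mulr_sumr; apply: eq_bigr => i _.
by rewrite mxE normcM exprMn.
Qed.

Lemma vnorm_ge0 m (x : 'cV[C]_m) : 0 <= vnorm x.
Proof. exact: sqrtr_ge0. Qed.

End InnerProduct.

Section Runs.
Variables (R : realType) (n : nat).
Local Notation C := (R[i]).
Variable A : 'M[C]_n.+1.

Section Arnoldi.
Variable v : 'cV[C]_n.+1.
Local Notation q := (process_vec A (fun=> 0%N) v).

Lemma normalized (w : 'cV[C]_n.+1) :
  let u := (vnorm w)%:C^-1 *: w in cdot u u = 1 \/ u = 0.
Proof.
have [h|h] := eqVneq (vnorm w) 0; first by right; rewrite (vnorm_eq0 h) scaler0.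
left; rewrite cdotxx vnormZ normcV normc_real ger0_norm ?vnorm_ge0 //.
by rewrite mulVf // expr1n.
Qed.

Lemma arnoldi_orthonormal k :
  (forall i j, (i < k)%N -> (j < k)%N -> i != j -> cdot (q i) (q j) = 0) /\
  (forall i, (i < k)%N -> cdot (q i) (q i) = 1 \/ q i = 0).
Proof.
have nrm i : cdot (q i) (q i) = 1 \/ q i = 0.
  by case: i => [|i]; [exact: normalized|rewrite process_vecS; exact: normalized].
split; last by move=> i _.
suff lt i j : (j < k)%N -> (i < j)%N -> cdot (q i) (q j) = 0.
  move=> i j ik jk; rewrite neq_ltn => /orP[ij|ji]; first exact: lt.
  by rewrite cdot_conj lt // rmorph0.
elim: k i j => [//|k IH] i j; rewrite ltnS leq_eqVlt => /orP[/eqP ->|]; last exact: IH.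
case: k IH => [//|k] IH ik.
rewrite process_vecS cdotZr /process_step subn0 mgs_orthogonal ?mulr0 //.
move=> a c ak ck; rewrite neq_ltn => /orP[ac|ca]; first exact: IH.
by rewrite cdot_conj IH // rmorph0.
Qed.

Lemma arnoldi_perp p : perp_B (arnoldi A v p).
Proof.
apply/colP => i; rewrite [RHS]mxE.
have [h _] := arnoldi_orthonormal p.+2.
have <- : cdot (q i) (q p.+1) = 0.
  by apply: h => //; [exact: (ltn_trans (ltn_ord i))|rewrite ltn_eqF].
by rewrite cdotE mxE; apply: eq_bigr => l _; rewrite !mxE.
Qed.

End Arnoldi.

(** Only the last column of the Hessenberg matrix changes. *)
Lemma rank1_arnoldi_like v (D D' : decomp R n) :
  arnoldi_like A v D -> rank1_update D D' -> arnoldi_like A v D'.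
Proof.
move=> [hrel hH hB hK hv] [c [bt [a [a0 hn ->]]]]; split=> //=.
  rewrite hrel hn mulmxDr -scalemxAr mulmxA -addrA; congr (_ + _).
  by rewrite mulmxDl scalerDr -!scalemxAl scalerA [a * _]mulrC.
move=> i j ij; rewrite !mxE big_ord1 !mxE hH // add0r.
rewrite (_ : (j == ord_max) = false) ?andbF ?mulr0 //.
apply/eqP => e; move: ij; rewrite e /= ltnNge; by rewrite -ltnS (leq_trans (ltn_ord i)).
Qed.

Lemma adaptive_extendable perp b t S tau mmax (D : nat -> decomp R n) :
  no_breakdown A b D -> adaptive_run perp A b t S tau mmax D ->
  forall k, extendable A (start b D k) (D k).
Proof.
move=> hb hr k; have [_ h1 _] := hr k; split; last exact: hb.
apply: rank1_arnoldi_like h1; apply: process_arnoldi_like.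
exact: (hb k (mlen (D k)) (leqnSn _)).
Qed.

(** No nonzero vector of the Krylov space is orthogonal to it. *)
Lemma arnoldi_run_equivalent g b t S tau mmax (D D' : nat -> decomp R n) :
  stieltjes_density g -> no_breakdown A b D ->
  adaptive_run (@perp_B R n) A b t S tau mmax D -> matfuns_defined D ->
  arnoldi_run A b D' -> same_lengths D D' -> same_approx g D D'.
Proof.
move=> gS hb hr hspec hr' hl.
have hD := adaptive_extendable hb hr.
apply: (same_approx_collinear gS hD _ hl _ hspec) => k.
  move=> hk; rewrite (hr' k); apply: process_arnoldi_like.
  exact: hk.
move=> he hrange.
apply: (nextv_collinear (Q := (basis (D k))^t*) (hD k) he hrange).
- move=> x hx h; have := proj1 (orthogonalP (basis (D k)) x) h _ hx; rewrite cdotxx.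
  by move=> /(congr1 (@complex.Re R)) /= /eqP; rewrite sqrf_eq0 => /eqP/vnorm_eq0.
- by have [_ _] := hr k.
- apply: (proj2 (orthogonalP _ _)) => y /hrange.
  apply: (proj1 (orthogonalP _ _)).
  by rewrite (hr' k); exact: arnoldi_perp.
Qed.

(** Invertibility of the Gram matrix says that no nonzero vector of the Krylov
    space K is orthogonal to A K. *)
Lemma harmonic_run_equivalent g b t S tau mmax (D D' : nat -> decomp R n) :
  stieltjes_density g -> no_breakdown A b D ->
  adaptive_run (perp_AB A) A b t S tau mmax D ->
  (forall k, AB_gram A (D k) \in unitmx) -> matfuns_defined D ->
  harmonic_run A b D' -> same_lengths D D' -> same_approx g D D'.
Proof.
move=> gS hb hr hu hspec hr' hl.
have hD := adaptive_extendable hb hr.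
apply: (same_approx_collinear gS hD _ hl _ hspec) => k.
  by have [_ _ []] := hr' k.
move=> he hrange.
apply: (nextv_collinear (Q := (A *m basis (D k))^t*) (hD k) he hrange).
- move=> x [c ->]; rewrite mulmxA => h.
  by rewrite -[c]mul1mx -(mulVmx (hu k)) -mulmxA h !mulmx0.
- by have [_ _] := hr k.
- have [_ _ _ _ hp] := hr' k.
  apply: (proj2 (orthogonalP _ _)) => _ [c ->]; apply: (proj1 (orthogonalP _ _) hp).
  have /hrange[d hd] : in_range (basis (D k)) (basis (D k) *m c) by exists c.
  by exists d; rewrite -!mulmxA hd.
Qed.

End Runs.

(** * Coercivity *)
Section RealInnerProduct.
Variables (R : realType) (m : nat).
Local Notation C := (R[i]).
Implicit Types (x y z : 'cV[C]_m) (M : 'M[C]_m) (a s : R).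

(** Real bilinear, symmetric, and with the same norm as the Hermitian product;
    the convergence estimates need no more than that. *)
Definition rip x y : R := Re (cdot x y).
Definition sqn x : R := rip x x.

Lemma ripC x y : rip x y = rip y x.
Proof. by rewrite /rip cdot_conj; case: (cdot y x). Qed.
Lemma ripDr x y z : rip x (y + z) = rip x y + rip x z.
Proof. by rewrite /rip /cdot mulmxDr mxE cReD. Qed.
Lemma ripNr x y : rip x (- y) = - rip x y.
Proof. by rewrite /rip /cdot mulmxN mxE cReN. Qed.
Lemma ripDl x y z : rip (x + y) z = rip x z + rip y z.
Proof. by rewrite ripC ripDr !(ripC z). Qed.
Lemma ripNl x y : rip (- x) y = - rip x y.
Proof. by rewrite ripC ripNr ripC. Qed.
Lemma ripZr a x y : rip x (a%:C *: y) = a * rip x y.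
Proof. by rewrite /rip cdotZr cReM /= mul0r subr0. Qed.
Lemma ripZl a x y : rip (a%:C *: x) y = a * rip x y.
Proof. by rewrite ripC ripZr ripC. Qed.
Lemma sqn_vnorm x : sqn x = vnorm x ^+ 2.
Proof. by rewrite /sqn /rip cdotxx. Qed.
Lemma sqn_ge0 x : 0 <= sqn x.
Proof. by rewrite sqn_vnorm sqr_ge0. Qed.
Lemma sqn_gt0 x : x != 0 -> 0 < sqn x.
Proof.
move=> x0; rewrite sqn_vnorm exprn_gt0 // lt_neqAle vnorm_ge0 andbT eq_sym.
by apply: contraNneq x0 => /vnorm_eq0 ->.
Qed.
Lemma sqnZ (c : C) x : sqn (c *: x) = normc c ^+ 2 * sqn x.
Proof. by rewrite !sqn_vnorm vnormZ exprMn. Qed.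

Lemma rip_adj M x y : rip (M *m x) y = rip x (M^t* *m y).
Proof. by rewrite /rip cdot_mulmx. Qed.

Lemma sqnD x y : sqn (x + y) = sqn x + 2 * rip x y + sqn y.
Proof. by rewrite /sqn ripDl !ripDr (ripC y x); ring. Qed.

(** Young's inequality; it takes the place of Cauchy-Schwarz throughout. *)
Lemma rip_young s x y : 0 < s -> 2 * rip x y <= s * sqn x + sqn y / s.
Proof.
move=> s0; have := sqn_ge0 (s%:C *: x + (- y)).
rewrite sqnD sqnZ /sqn ripNr ripNl ripNr ripZl normc_real (ger0_norm (ltW s0)) -!/(sqn _).
move=> h; rewrite -subr_ge0 -(pmulr_lge0 _ s0).
have -> : (s * sqn x + sqn y / s - 2 * rip x y) * s =
   s ^+ 2 * sqn x + 2 * - (s * rip x y) + - - sqn y.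
  by field; rewrite gt_eqF.
by [].
Qed.

Lemma mulmx_bound M : exists2 L : R, 0 < L & forall x, sqn (M *m x) <= L * sqn x.
Proof.
pose r i : R := \sum_j normc (M i j).
exists (1 + \sum_i r i ^+ 2) => [|x].
  by rewrite ltr_wpDr ?ltr01 // sumr_ge0 // => i _; rewrite sqr_ge0.
apply: le_trans (_ : (\sum_i r i ^+ 2) * sqn x <= _); last first.
  by rewrite ler_wpM2r ?sqn_ge0 // lerDr ler01.
have sqnE y : sqn y = \sum_i normc (y i 0) ^+ 2.
  by rewrite sqn_vnorm sqr_sqrtr // sumr_ge0 // => i _; rewrite sqr_ge0.
rewrite {1}sqnE mulr_suml; apply: ler_sum => i _.
have xj j : normc (x j 0) <= vnorm x.
  rewrite -ler_sqr ?nnegrE ?normc_ge0 ?vnorm_ge0 // -sqn_vnorm sqnE (bigD1 j) //=.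
  by rewrite lerDl sumr_ge0 // => k _; rewrite sqr_ge0.
rewrite sqn_vnorm -exprMn lerXn2r ?nnegrE ?normc_ge0 //.
  by rewrite mulr_ge0 ?vnorm_ge0 // sumr_ge0 // => j _; exact: normc_ge0.
rewrite mxE; apply: le_trans (normc_sum _ _ _) _.
rewrite mulr_suml; apply: ler_sum => j _.
by rewrite normcM ler_wpM2l ?normc_ge0.
Qed.

(** Put y = M^-1 x. Expanding the nonnegative form at x - s y and choosing s
    from a bound on M^-1 gives the estimate, without compactness or spectral
    theory. *)
Lemma hermitian_coercive M : M^t* = M -> (forall x, x != 0 -> 0 < rip x (M *m x)) ->
  exists2 d : R, 0 < d & forall x, d * sqn x <= rip x (M *m x).
Proof.
move=> hM hp.
have ge0 x : 0 <= rip x (M *m x).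
  have [->|/hp/ltW //] := eqVneq x 0.
  by rewrite mulmx0 /rip /cdot mulmx0 mxE.
have uM : M \in unitmx.
  apply: unitmx_inj => c hc; apply: contrapT => /eqP/hp.
  by rewrite hc /rip /cdot mulmx0 mxE ltxx.
have [L L0 hL] := mulmx_bound (invmx M).
pose s := 2 / (L + 1); exists s => [|x]; first by rewrite divr_gt0 // addr_gt0.
set y := invmx M *m x.
have My : M *m y = x by rewrite mulmxA mulmxV // mul1mx.
have yx : 2 * rip y x <= (L + 1) * sqn x.
  have := rip_young y x ltr01; rewrite mul1r divr1 => /le_trans; apply.
  by rewrite mulrDl mul1r lerD2r hL.
have yMx : rip y (M *m x) = sqn x by rewrite -{1}hM -rip_adj My.
have := ge0 (x - s%:C *: y).
rewrite mulmxBr -scalemxAr My ripDl ripNl ripZl !ripDr !ripNr !ripZr yMx -/(sqn x) => h.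
have e : s * (L + 1) = 2 by rewrite /s divfK // gt_eqF // addr_gt0.
have s0 : 0 < s by rewrite divr_gt0 // addr_gt0.
have : s * (s * (2 * rip y x)) <= s * (s * ((L + 1) * sqn x)) by rewrite !ler_pM2l.
rewrite [s * ((L + 1) * _)]mulrA e => h2.
lra.
Qed.

Lemma positive_real_coercive M : positive_real M ->
  exists2 d : R, 0 < d & forall x, d * sqn x <= rip x (M *m x).
Proof.
move=> hp; have half x : rip x ((M + M^t*) *m x) = 2 * rip x (M *m x).
  by rewrite mulmxDl ripDr -rip_adj (ripC (M *m x)); ring.
have [|x x0|d d0 hd] := @hermitian_coercive (M + M^t*).
- rewrite raddfD /= map_mxD addrC; congr (_ + _).
  by apply/matrixP => i j; rewrite !mxE /= conjCK.
- by rewrite half mulr_gt0 //; exact: hp.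
exists (d / 2) => [|x]; first by rewrite divr_gt0.
have := hd x; rewrite half; lra.
Qed.

Lemma hermitian_posdef_adj M : hermitian_posdef M -> M^t* = M.
Proof.
by move=> [/is_hermitianmxP h _]; rewrite [RHS]h expr0 scale1r.
Qed.

Lemma hermitian_posdef_positive_real M : hermitian_posdef M -> positive_real M.
Proof. by move=> [_ h] x /h; rewrite ltcE => /andP[]. Qed.

End RealInnerProduct.

(** * Spectra of the compressions and the error of the restarted method *)
Section Convergence.
Variables (R : realType) (n : nat).
Local Notation C := (R[i]).
Variable A : 'M[C]_n.+1.

Lemma off_cut_Re_gt0 m (H : 'M[C]_m) :
  (forall a, eigenvalue H a -> 0 < Re a) -> spectrum_off_cut H.
Proof.
move=> h a /h a0; rewrite le0c_ReIm negb_and -ltNge a0; by [].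
Qed.

Lemma cdotxx_gt0 (x : 'cV[C]_n.+1) : x != 0 -> cdot x x = (sqn x)%:C /\ 0 < sqn x.
Proof. by move=> x0; rewrite sqn_gt0 // cdotxx sqn_vnorm. Qed.

Lemma positive_real_eig a : positive_real A -> eigenvalue A a -> 0 < Re a.
Proof.
move=> hA /eigenvalue_colP[c + c0]; rewrite mulmxBl mul_scalar_mx => /eqP.
rewrite subr_eq0 eq_sym => /eqP hc; have := hA c c0.
have [e p] := cdotxx_gt0 c0.
by rewrite hc cdotZr e cReM /= mulr0 subr0 pmulr_lgt0.
Qed.

Lemma ritz_pair v (D : decomp R n) (a : C) : extendable A v D ->
  eigenvalue (hess D) a -> exists x mu, [/\ in_range (basis D) x, x != 0 &
    A *m x = a *: x + mu *: nextv D].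
Proof.
move=> [[hrel _ hB _ _] _] /eigenvalue_colP[c hc c0].
exists (basis D *m c), (subdiag D * c ord_max 0); split; first by exists c.
  by apply: contraNneq c0 => /(basis_inj hB) ->.
rewrite (arnoldi_apply _ hrel) scalemxAr; congr (basis D *m _ + _).
by apply/eqP; rewrite eq_sym -subr_eq0 -mul_scalar_mx -mulmxBl hc.
Qed.

(** By orthogonality of the next vector, a Ritz value is a Rayleigh quotient
    of A. *)
Lemma ritz_Re_gt0 v D a : positive_real A -> extendable A v D -> perp_B D ->
  eigenvalue (hess D) a -> 0 < Re a.
Proof.
move=> hA hD hp ha; have [x [mu [hx x0 hAx]]] := ritz_pair hD ha.
have := hA x x0; rewrite hAx.
rewrite /cdot mulmxDr mxE -/(cdot x _) -/(cdot x _) !cdotZr.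
rewrite (proj1 (orthogonalP _ _) hp x hx) mulr0 addr0.
have [-> p] := cdotxx_gt0 x0.
by rewrite cReM /= mulr0 subr0 pmulr_lgt0.
Qed.

(** With y = A x, orthogonality gives |y|^2 = a y^* x, so the inverse of a
    has a positive real part, as x^* A x has. *)
Lemma harmonic_ritz_Re_gt0 v D a : positive_real A -> extendable A v D -> perp_AB A D ->
  eigenvalue (hess D) a -> 0 < Re a.
Proof.
move=> hA hD hp ha; have [x [mu [hx x0 hAx]]] := ritz_pair hD ha.
have p := hA x x0.
have y0 : A *m x != 0.
  by apply: contraTneq p => ->; rewrite /cdot mulmx0 mxE ltxx.
have ry : in_range (A *m basis D) (A *m x).
  by case: hx => c ->; exists c; rewrite mulmxA.
have [e py] := cdotxx_gt0 y0.
have E : (sqn (A *m x))%:C = a * cdot (A *m x) x.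
  rewrite -e {2}hAx /cdot mulmxDr mxE -/(cdot _ x) -!/(cdot _ _) !cdotZr.
  by rewrite (proj1 (orthogonalP _ _) hp _ ry) mulr0 addr0.
move: E; rewrite cdot_conj; set w := cdot x (A *m x) in p *.
move=> E; have e1 : sqn (A *m x) = Re a * Re w + Im a * Im w.
  by move/(congr1 (@complex.Re R)): E; rewrite cReM; case: (w) => ? ? /= ->; ring.
have e2 : 0 = Im a * Re w - Re a * Im w.
  by move/(congr1 (@complex.Im R)): E; rewrite cImM; case: (w) => ? ? /= ->; ring.
have e3 : sqn (A *m x) * Re w = Re a * (Re w ^+ 2 + Im w ^+ 2).
  transitivity (Re a * Re w ^+ 2 + (Im a * Re w) * Im w); first by rewrite e1; ring.
  have -> : Im a * Re w = Re a * Im w by lra.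
  by ring.
have : 0 < Re a * (Re w ^+ 2 + Im w ^+ 2) by rewrite -e3 mulr_gt0.
by rewrite pmulr_lgt0 // ltr_pwDl ?exprn_gt0 // sqr_ge0.
Qed.

(** Moving t to the left of the origin increases the distance to every point of
    the right half plane. *)
Lemma det_shift_le m (H : 'M[C]_m) (t : R) : (forall a, eigenvalue H a -> 0 < Re a) ->
  t <= 0 -> normc (\det (0%:M - H)) <= normc (\det ((t%:C)%:M - H)).
Proof.
move=> h t0; have [s hd hs] := det_shift_roots H; rewrite !hd.
have {hs} : forall a, a \in s -> 0 < Re a by move=> a; rewrite hs; exact: h.
elim: s {hd} => [|a s IH] hs; first by rewrite !big_nil.
rewrite !big_cons !normcM ler_pM ?normc_ge0 ?IH //; last first.
  by move=> y ys; apply: hs; rewrite in_cons ys orbT.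
rewrite -ler_sqr ?nnegrE ?normc_ge0 // !normc_sqr !cReD !cImD !cReN !cImN /=.
have := hs a (mem_head _ _); nra.
Qed.

Section Error.
Variables (g : R -> R) (b : 'cV[C]_n.+1) (D : nat -> decomp R n).
Hypotheses (gS : stieltjes_density g) (hA : spectrum_off_cut A).
Hypothesis hD : forall k, extendable A (start b D k) (D k).
Hypothesis hspec : matfuns_defined D.

(** In the cycles before the k-th, each shifted system (t - A) x = b is solved
    approximately by adding up the vectors update; resid is its residual and
    shift_err its error. *)
Definition resid k (t : R) : 'cV[C]_n.+1 := rho D k t *: start b D k.
Definition update k (t : R) : 'cV[C]_n.+1 := rho D k t *: shift_solve (D k) t%:C.

Lemma resid_step k t : t <= 0 ->
  resid k.+1 t = resid k t - ((t%:C)%:M - A) *m update k t.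
Proof.
move=> t0; rewrite /resid rhoS -[LHS]scalerA.
rewrite -(shift_residual (hD k).1 (shift_unit (@hspec k) t0)).
by rewrite scalerBr -[in RHS]scalemxAr.
Qed.

Definition shift_err k (t : R) : 'cV[C]_n.+1 := invmx ((t%:C)%:M - A) *m resid k t.

Lemma shift_err_step k t : t <= 0 -> shift_err k.+1 t = shift_err k t - update k t.
Proof.
move=> t0; rewrite /shift_err resid_step // mulmxBr mulmxA mulVmx ?mul1mx //.
exact: shift_unit.
Qed.

Lemma tame_shift_err k i : tame 1 (fun t : R => shift_err k t i 0).
Proof.
pose T (t : R) := \sum_j start b D k j 0 * (rho D k t * invmx ((t%:C)%:M - A) i j).
apply: (@eq_tame _ _ T) => [t _|]; last first.
  apply: tame_sum => j; apply: tameZ; apply: (@tameM _ 0 1); first exact: tame_rho.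
  exact: tame_invmx.
rewrite /shift_err /resid -scalemxAr !mxE mulr_sumr; apply: eq_bigr => j _.
by ring.
Qed.

Lemma matfun_entry i : (matfun (stieltjes_fun g) A *m b) i 0 =
  stint g (fun t => shift_err 0 t i 0).
Proof.
have -> : stieltjes_fun g = stieltjes (fun t => (g t)%:C * 1).
  by congr stieltjes; apply/funext => t; rewrite mulr1.
rewrite (@matfun_stieltjes _ g (fun=> 1)) //; last exact: tame_cst.
pose T (t : R) := \sum_j b j 0 * (1 * invmx ((t%:C)%:M - A) i j).
rewrite [RHS](@eq_stint _ g _ T) => [|t _]; last first.
  by rewrite /shift_err /resid /= scale1r mxE; apply: eq_bigr => j _; rewrite mul1r mulrC.
have tj j : tame 1 (fun t : R => 1 * invmx ((t%:C)%:M - A) i j).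
  by apply: tameZ; exact: tame_invmx.
rewrite stint_sum //; last by move=> j; exact: tameZ.
by rewrite mxE; apply: eq_bigr => j _; rewrite stintZ // mxE mulrC.
Qed.

(** The integrals of the updates telescope. *)
Lemma restart_error k i :
  (restart_approx g D k - matfun (stieltjes_fun g) A *m b) i 0 =
  - stint g (fun t => shift_err k.+1 t i 0).
Proof.
have entryB (x y : 'cV[C]_n.+1) : (x - y) i 0 = x i 0 - y i 0 by rewrite !mxE.
rewrite entryB matfun_entry.
pose e l := stint g (fun t => shift_err l t i 0).
have step l : correction g D l i 0 = e l - e l.+1.
  rewrite /e -stintB //; try exact: tame_shift_err.
  rewrite correction_entry //; apply: eq_stint => t t0.
  rewrite shift_err_step // entryB opprB addrC subrK.
  by rewrite [RHS]mxE.
rewrite -/(e 0%N) -/(e k.+1); move: e step => e step.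
have -> : restart_approx g D k i 0 = e 0%N - e k.+1.
  elim: k => [|k IH]; first exact: step.
  have -> : restart_approx g D k.+1 i 0 = restart_approx g D k i 0 + correction g D k.+1 i 0.
    by rewrite /= mxE.
  by rewrite IH step addrA subrK.
by rewrite addrAC subrr add0r.
Qed.

(** A geometric rate in k that is uniform in t, with the weight that makes it
    integrable, passes to the integral. *)
Lemma convergence_criterion (K q : R) : 0 <= q < 1 ->
  (forall k t, t <= 0 -> (1 - t) ^+ 2 * sqn (shift_err k t) <= K * q ^+ k) ->
  converges_to (restart_approx g D) (matfun (stieltjes_fun g) A *m b).
Proof.
move=> /andP[q0 q1] hK.
have K0 : 0 <= K.
  have := hK 0%N 0 (lexx _); rewrite expr0 mulr1; apply: le_trans.
  by rewrite mulr_ge0 ?sqr_ge0 ?sqn_ge0.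
have hb k i : normc (stint g (fun t => shift_err k t i 0)) <=
    2 * (Num.sqrt K * Num.sqrt q ^+ k) * mass g.
  apply: stint_bound => //; first exact: tame_shift_err.
  move=> t t0; have t1 : 0 <= 1 - t by lra.
  rewrite -ler_sqr ?nnegrE ?mulr_ge0 ?normc_ge0 ?exprn_ge0 ?sqrtr_ge0 //.
  rewrite !exprMn -exprM mulnC exprM !sqr_sqrtr //.
  apply: le_trans (hK k t t0); rewrite ler_wpM2l ?sqr_ge0 // sqn_vnorm sqr_sqrtr.
    by rewrite (bigD1 i) //= lerDl sumr_ge0 // => j _; rewrite sqr_ge0.
  by rewrite sumr_ge0 // => j _; rewrite sqr_ge0.
pose c := n.+1%:R * (2 * Num.sqrt K * mass g).
have hv k : vnorm (restart_approx g D k - matfun (stieltjes_fun g) A *m b) <=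
    c * Num.sqrt q ^+ k.+1.
  have le_sum (x : 'cV[C]_n.+1) : vnorm x <= \sum_i normc (x i 0).
    rewrite -ler_sqr ?nnegrE ?vnorm_ge0 ?sumr_ge0 // => [|i _]; last exact: normc_ge0.
    rewrite sqr_sqrtr; last by rewrite sumr_ge0 // => j _; rewrite sqr_ge0.
    rewrite expr2 mulr_suml; apply: ler_sum => i _.
    rewrite expr2 ler_wpM2l ?normc_ge0 // (bigD1 i) //= lerDl sumr_ge0 // => j _.
    exact: normc_ge0.
  apply: le_trans (le_sum _) _.
  apply: le_trans (_ : \sum_(i < n.+1) 2 * (Num.sqrt K * Num.sqrt q ^+ k.+1) * mass g <= _).
    by apply: ler_sum => i _; rewrite restart_error normcN.
  rewrite sumr_const card_ord -mulr_natl /c le_eqVlt; apply/orP; left; apply/eqP.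
  by ring.
rewrite /converges_to.
have lim : c * Num.sqrt q ^+ k.+1 @[k --> \oo] --> (0 : R).
  rewrite -(mulr0 c); apply: cvgM; first exact: cvg_cst.
  have h : (fun k => Num.sqrt q ^+ k : R) @ \oo --> (0 : R).
    apply: cvg_expr; rewrite ger0_norm ?sqrtr_ge0 //.
    by rewrite -(sqrtr1 R) ltr_sqrt.
  by rewrite (cvg_shiftS (fun k => Num.sqrt q ^+ k : R)).
apply: (squeeze_cvgr _ (cvg_cst 0) lim).
by apply: nearW => k; rewrite vnorm_ge0 hv.
Qed.

End Error.

End Convergence.

(** * Linear rates for the shifted systems *)
Section Bounds.
Variables (R : realType) (n : nat).
Local Notation C := (R[i]).
Implicit Types (M A : 'M[C]_n.+1) (x y w : 'cV[C]_n.+1).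

Lemma coercive_energy M (d : R) e w : 0 < d -> d * sqn e <= rip e (M *m e) ->
  M *m e = - w -> rip e (M *m e) <= sqn w / d.
Proof.
move=> d0 hd he; have := rip_young (- e) w d0.
have -> : rip (- e) w = rip e (M *m e) by rewrite he ripNl ripNr.
have -> : sqn (- e) = sqn e by rewrite /sqn ripNl ripNr opprK.
lra.
Qed.

Let energy_arith (a d p p' r s c : R) : p - 2 * (a * s) + a * (a * c) = p' + r ->
  0 <= r -> a * (a * c) <= a * s -> a * (p * d) <= a * s -> p' <= p - a * (p * d).
Proof. by lra. Qed.

(** A Galerkin step minimizes the energy norm of the error over a space that
    contains the residual w, hence it does at least as well as one step of
    steepest descent with the step length 1 / L. *)
Lemma energy_step M (d L : R) e e' x w : M^t* = M -> 0 < d -> 0 < L ->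
  (forall y, d * sqn y <= rip y (M *m y)) -> (forall y, rip y (M *m y) <= L * sqn y) ->
  M *m e = - w -> e' = e - x -> rip x (M *m e') = 0 -> rip w (M *m e') = 0 ->
  rip e' (M *m e') <= (1 - d / L) * rip e (M *m e).
Proof.
move=> hM d0 L0 hd hL he he' hx hw.
have sym y z : rip y (M *m z) = rip z (M *m y) by rewrite -{1}hM -rip_adj ripC.
have ge0 y : 0 <= rip y (M *m y).
  by apply: le_trans (hd y); rewrite mulr_ge0 ?sqn_ge0 // ltW.
pose a := L^-1; have a0 : 0 < a by rewrite invr_gt0.
pose u := x + a%:C *: w.
have eu : e' + u = e + a%:C *: w by rewrite he' /u addrA subrK.
have hu : rip u (M *m e') = 0 by rewrite ripDl ripZl hx hw mulr0 addr0.
have E1 : rip (e' + u) (M *m (e' + u)) = rip e' (M *m e') + rip u (M *m u).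
  by rewrite mulmxDr ripDl !ripDr (sym e' u) hu addr0 add0r.
have E2 : rip (e + a%:C *: w) (M *m (e + a%:C *: w)) =
    rip e (M *m e) - 2 * (a * sqn w) + a * (a * rip w (M *m w)).
  rewrite mulmxDr -scalemxAr ripDl !ripDr !ripZr !ripZl (sym e w) he !ripNr -/(sqn w).
  by ring.
have aL : a * (a * rip w (M *m w)) <= a * sqn w.
  rewrite ler_pM2l // -(ler_pM2l L0) mulrA mulfV ?gt_eqF // mul1r; exact: hL.
move: E1; rewrite eu E2 => E3.
have := coercive_energy d0 (hd e) he; rewrite ler_pdivlMr // => wE.
have aE : a * (rip e (M *m e) * d) <= a * sqn w by rewrite ler_pM2l.
have -> : (1 - d / L) * rip e (M *m e) =
  rip e (M *m e) - a * (rip e (M *m e) * d).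
  by rewrite /a; move: (rip e _) => p; ring.
exact: energy_arith E3 (ge0 u) aL aE.
Qed.

(** Orthogonality to A K makes the residual u minimal over v + A K, hence not
    longer than v - a A v for the best step length a = d / L. *)
Lemma residual_step A (d L : R) v u z : 0 < L ->
  d * sqn v <= rip v (A *m v) -> sqn (A *m v) <= L * sqn v ->
  u = v - A *m z -> rip (A *m z) u = 0 -> rip (A *m v) u = 0 ->
  0 <= d -> sqn u <= (1 - d ^+ 2 / L) * sqn v.
Proof.
move=> L0 hd hL hu uz uv d0.
pose a := d / L; have a0 : 0 <= a by rewrite divr_ge0 // ltW.
pose y := z + (- a)%:C *: v.
have E : v - a%:C *: (A *m v) = u + A *m y.
  rewrite hu /y mulmxDr -scalemxAr rmorphN scaleNr addrA subrK; by [].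
have o : rip u (A *m y) = 0.
  by rewrite ripC /y mulmxDr -scalemxAr ripDl ripZl uz uv mulr0 addr0.
have := sqnD u (A *m y); rewrite o mulr0 addr0 -E => E1.
have E2 : sqn (v - a%:C *: (A *m v)) =
    sqn v - 2 * (a * rip v (A *m v)) + a ^+ 2 * sqn (A *m v).
  rewrite sqnD ripNr ripZr mulrN; congr (_ + _).
  by rewrite -scaleN1r scalerA sqnZ normcM normcN !normc_real normr1 mul1r ger0_norm.
have u_le : sqn u <= sqn v - 2 * (a * rip v (A *m v)) + a ^+ 2 * sqn (A *m v).
  by rewrite -E2 E1 lerDl sqn_ge0.
apply: le_trans u_le _.
have h1 : a * (d * sqn v) <= a * rip v (A *m v) by rewrite ler_wpM2l.
have h2 : a ^+ 2 * sqn (A *m v) <= a ^+ 2 * (L * sqn v) by rewrite ler_wpM2l ?sqr_ge0.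
have -> : (1 - d ^+ 2 / L) * sqn v = sqn v - 2 * (a * (d * sqn v)) + a ^+ 2 * (L * sqn v).
  by move: (sqn v) => s; rewrite /a; field; rewrite gt_eqF.
by rewrite -!addrA lerD2l lerD // lerN2 ler_pM2l.
Qed.

End Bounds.

Section Rates.
Variables (R : realType) (n : nat).
Local Notation C := (R[i]).
Variable A : 'M[C]_n.+1.
Variables (b : 'cV[C]_n.+1) (D : nat -> decomp R n).
Hypothesis hA : positive_real A.
Hypothesis hD : forall k, extendable A (start b D k) (D k).

Lemma rip_shift (t : R) (x : 'cV[C]_n.+1) :
  rip x ((A - (t%:C)%:M) *m x) = rip x (A *m x) - t * sqn x.
Proof. by rewrite mulmxBl mul_scalar_mx ripDr ripNr ripZr. Qed.

Lemma shift_errE k t : spectrum_off_cut A -> t <= 0 ->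
  (A - (t%:C)%:M) *m shift_err A b D k t = - resid b D k t.
Proof.
move=> hs t0; rewrite -[A - _]opprB mulNmx /shift_err mulmxA mulmxV ?mul1mx //.
exact: shift_unit.
Qed.

Lemma positive_real_off_cut : spectrum_off_cut A.
Proof. by apply: off_cut_Re_gt0 => a; exact: positive_real_eig. Qed.

(** Converts the decay 1 / (d - t) of the resolvent into the weight 1 / (1 - t). *)
Lemma weight_le (d t : R) : 0 < d -> t <= 0 -> 1 - t <= (1 + d^-1) * (d - t).
Proof.
move=> d0 t0; have -> : (1 + d^-1) * (d - t) = d - t + (1 - t / d) by field; rewrite gt_eqF.
have : t / d <= 0 by rewrite mulr_le0_ge0 // invr_ge0 ltW.
lra.
Qed.

Lemma weighted_err (d K : R) k t : 0 < d -> t <= 0 ->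
  (d - t) ^+ 2 * sqn (shift_err A b D k t) <= K ->
  (1 - t) ^+ 2 * sqn (shift_err A b D k t) <= (1 + d^-1) ^+ 2 * K.
Proof.
move=> d0 t0 h; apply: le_trans (_ : ((1 + d^-1) * (d - t)) ^+ 2 * sqn (shift_err A b D k t) <= _).
  rewrite ler_wpM2r ?sqn_ge0 // lerXn2r ?nnegrE ?weight_le //; first by lra.
  by rewrite mulr_ge0 ?addr_ge0 ?invr_ge0 //; lra.
by rewrite exprMn -mulrA ler_wpM2l ?sqr_ge0.
Qed.

Lemma range_resid k t : in_range (basis (D k)) (resid b D k t).
Proof.
have [[_ _ _ _ hv] _] := hD k; have [c hc] := range_start hv.
by exists (rho D k t *: c); rewrite /resid hc scalemxAr.
Qed.

Lemma range_update k t : in_range (basis (D k)) (update D k t).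
Proof. by eexists; rewrite /update /shift_solve -mulmxA scalemxAr. Qed.

(** The rate 1 - (d - t) / (L - t) of the energy norm for the shift t is at most
    1 - d / L. *)
Lemma arnoldi_rate : hermitian_posdef A -> (forall k, perp_B (D k)) ->
  matfuns_defined D -> exists K q : R, 0 <= q < 1 /\ forall k t, t <= 0 ->
    (1 - t) ^+ 2 * sqn (shift_err A b D k t) <= K * q ^+ k.
Proof.
move=> hH hp hspec.
have [d d0 hd] := positive_real_coercive hA.
have [L0 L00 hL0] := mulmx_bound A.
(* Young's inequality gives the bound (1 + L0) / 2; adding d makes q nonnegative. *)
pose L := d + (1 + L0) / 2.
have Ld : d < L by rewrite /L; lra.
have hL x : rip x (A *m x) <= L * sqn x.
  have := rip_young x (A *m x) ltr01; rewrite mul1r divr1 => h.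
  have := hL0 x; have := sqn_ge0 x; move: h; rewrite /L.
  move: (rip x _) (sqn (A *m x)) (sqn x) => p r s *; nra.
pose q := 1 - d / L.
have L_gt0 : 0 < L by lra.
have q01 : 0 <= q < 1.
  rewrite /q subr_ge0 ltrBlDr ltrDl divr_gt0 // andbT ler_pdivrMr // mul1r; exact: ltW.
have [q0 _] := andP q01.
exists ((1 + d^-1) ^+ 2 * sqn b), q; split=> // k t t0.
have hs := positive_real_off_cut.
rewrite -[leRHS]mulrA; apply: weighted_err => //.
pose M := A - (t%:C)%:M; pose E j := rip (shift_err A b D j t) (M *m shift_err A b D j t).
have dt : 0 < d - t by lra.
have Lt : 0 < L - t by lra.
have hM : M^t* = M.
  rewrite /M raddfB /= map_mxB hermitian_posdef_adj // tr_scalar_mx map_scalar_mx.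
  by congr (_ - _%:M); exact: conjc_real.
have hMd x : (d - t) * sqn x <= rip x (M *m x).
  by rewrite rip_shift mulrBl lerD2r.
have hML x : rip x (M *m x) <= (L - t) * sqn x.
  by rewrite rip_shift mulrBl lerD2r.
have perp j x : in_range (basis (D j)) x -> rip x (M *m shift_err A b D j.+1 t) = 0.
  move=> hx; rewrite shift_errE // ripNr /rip /resid cdotZr.
  by rewrite (proj1 (orthogonalP _ _) (hp j) _ hx) mulr0 oppr0.
have E0 j : 0 <= E j.
  by apply: le_trans (hMd _); rewrite mulr_ge0 ?sqn_ge0 // ltW.
have Estep j : E j.+1 <= q * E j.
  have st := energy_step hM dt Lt hMd hML (shift_errE j hs t0) (shift_err_step hs hD hspec j t0)
    (perp j _ (range_update j t)) (perp j _ (range_resid j t)).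
  apply: le_trans st _; rewrite ler_wpM2r ?E0 // /q lerD2l lerN2.
  by rewrite ler_pdivrMr // mulrAC ler_pdivlMr //; nra.
have Ek j : E j <= q ^+ j * E 0%N.
  elim: j => [|j IH]; first by rewrite expr0 mul1r.
  by apply: le_trans (Estep j) _; rewrite exprS -mulrA ler_wpM2l.
have Eb : E 0%N <= sqn b / (d - t).
  apply: coercive_energy => //.
  by rewrite shift_errE // /resid /= scale1r.
apply: le_trans (_ : (d - t) * E k <= _).
  rewrite expr2 -[leLHS]mulrA ler_wpM2l //; exact: ltW.
apply: le_trans (_ : (d - t) * (q ^+ k * (sqn b / (d - t))) <= _).
  rewrite ler_wpM2l //; first exact: ltW.
  by apply: le_trans (Ek k) _; rewrite ler_wpM2l ?exprn_ge0.
have -> : (d - t) * (q ^+ k * (sqn b / (d - t))) = sqn b * q ^+ k.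
  by move: (sqn b) (q ^+ k) => s r; field; rewrite gt_eqF.
by [].
Qed.

(** For t = 0 the residual is that of a minimal residual method. The residual
    for t < 0 is a multiple of the same vector, by a factor that is not larger
    because the harmonic Ritz values lie in the right half plane. *)
Lemma harmonic_rate : (forall k, perp_AB A (D k)) ->
  matfuns_defined D -> exists K q : R, 0 <= q < 1 /\ forall k t, t <= 0 ->
    (1 - t) ^+ 2 * sqn (shift_err A b D k t) <= K * q ^+ k.
Proof.
move=> hp hspec.
have [d d0 hd] := positive_real_coercive hA.
have [L0 L00 hL0] := mulmx_bound A.
(* Adding d ^+ 2 makes q nonnegative. *)
pose L := d ^+ 2 + L0; pose q := 1 - d ^+ 2 / L.
have d20 : 0 < d ^+ 2 by rewrite exprn_gt0.
have L_gt0 : 0 < L by rewrite addr_gt0.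
have hL x : sqn (A *m x) <= L * sqn x.
  by apply: le_trans (hL0 x) _; rewrite ler_wpM2r ?sqn_ge0 // lerDr ltW.
have q01 : 0 <= q < 1.
  by rewrite /q subr_ge0 ltrBlDr ltrDl divr_gt0 // andbT ler_pdivrMr // mul1r lerDl ltW.
have [q0 _] := andP q01.
exists ((1 + d^-1) ^+ 2 * sqn b), q; split=> // k t t0.
have hs := positive_real_off_cut.
rewrite -[leRHS]mulrA; apply: weighted_err => //.
have dt : 0 < d - t by lra.
have hMd x : (d - t) * sqn x <= rip x ((A - (t%:C)%:M) *m x).
  by rewrite rip_shift mulrBl lerD2r.
have perp j c x : in_range (basis (D j)) x -> rip (A *m x) (c *: nextv (D j)) = 0.
  case=> y ->; rewrite /rip cdotZr (proj1 (orthogonalP _ _) (hp j)) ?mulr0 //.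
  by exists y; rewrite mulmxA.
have Wstep j : sqn (resid b D j.+1 t) <= q * sqn (resid b D j t).
  have [hl _] := hD j; have [_ _ _ _ hv] := hl.
  have u0 := shift_unit (@hspec j) (lexx 0).
  have := shift_residual hl u0; set kap0 := _ / _ => r0.
  have st : sqn (kap0 *: nextv (D j)) <= q * sqn (start b D j).
    apply: (@residual_step _ _ A d L _ _ (- shift_solve (D j) (0 : R)%:C)) => //; last exact: ltW.
    - by rewrite -r0 mulmxBl mul_scalar_mx scale0r sub0r mulmxN.
    - rewrite mulmxN ripNl perp ?oppr0 //.
      by eexists; rewrite /shift_solve -mulmxA.
    - by apply: perp; exact: range_start hv.
  rewrite /resid rhoS -[_ *: start b D j.+1]scalerA !sqnZ [leRHS]mulrCA.
  rewrite ler_wpM2l ?sqr_ge0 //; apply: le_trans st; rewrite sqnZ.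
  rewrite ler_wpM2r ?sqn_ge0 // lerXn2r ?nnegrE ?normc_ge0 //.
  rewrite /kap0 !normcM !normcV ler_wpM2l ?mulr_ge0 ?normc_ge0 // lef_pV2.
  - by apply: det_shift_le => // a; exact: harmonic_ritz_Re_gt0 (hD j) (hp j).
  - rewrite posrE lt_neqAle normc_ge0 andbT eq_sym normc_eq0.
    by have := shift_unit (@hspec j) t0; rewrite unitmxE unitfE.
  - rewrite posrE lt_neqAle normc_ge0 andbT eq_sym normc_eq0.
    by move: u0; rewrite unitmxE unitfE.
have Wk j : sqn (resid b D j t) <= q ^+ j * sqn b.
  elim: j => [|j IH]; first by rewrite expr0 mul1r /resid /= scale1r.
  by apply: le_trans (Wstep j) _; rewrite exprS -mulrA ler_wpM2l.
apply: le_trans (_ : sqn (resid b D k t) <= _); last by rewrite mulrC.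
have := coercive_energy dt (hMd _) (shift_errE k hs t0).
rewrite ler_pdivlMr // => h; apply: le_trans h.
by rewrite expr2 -[leLHS]mulrA mulrC ler_wpM2r // ltW.
Qed.

End Rates.

(** * Convergence of the restarted methods *)
Section Final.
Variables (R : realType) (n : nat).
Variables (A : 'M[R[i]]_n.+1) (b : 'cV[R[i]]_n.+1) (g : R -> R).
Variables (t : nat) (S : sketching R n) (tau : R) (mmax : nat) (D : nat -> decomp R n).
Hypothesis gS : stieltjes_density g.
Hypothesis hb : no_breakdown A b D.

Lemma arnoldi_converges : adaptive_run (@perp_B R n) A b t S tau mmax D ->
  hermitian_posdef A ->
  converges_to (restart_approx g D) (matfun (stieltjes_fun g) A *m b).
Proof.
move=> hr hH; have hA := hermitian_posdef_positive_real hH.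
have hD := adaptive_extendable hb hr.
have hp k : perp_B (D k) by have [] := hr k.
have hspec : matfuns_defined D.
  by move=> k; apply: off_cut_Re_gt0 => a; exact: ritz_Re_gt0 (hD k) (hp k).
have [K [q [hq hK]]] := arnoldi_rate hA hD hH hp hspec.
exact: (convergence_criterion gS (positive_real_off_cut hA) hD hspec hq hK).
Qed.

Lemma harmonic_converges : adaptive_run (perp_AB A) A b t S tau mmax D ->
  positive_real A ->
  converges_to (restart_approx g D) (matfun (stieltjes_fun g) A *m b).
Proof.
move=> hr hA; have hD := adaptive_extendable hb hr.
have hp k : perp_AB A (D k) by have [] := hr k.
have hspec : matfuns_defined D.
  by move=> k; apply: off_cut_Re_gt0 => a; exact: harmonic_ritz_Re_gt0 (hD k) (hp k).
have [K [q [hq hK]]] := harmonic_rate hA hD hp hspec.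
exact: (convergence_criterion gS (positive_real_off_cut hA) hD hspec hq hK).
Qed.

End Final.

Theorem theorem5p1 (R : realType) (n : nat)
    (A : 'M[R[i]]_n.+1) (b : 'cV[R[i]]_n.+1) (g : R -> R)
    (t : nat) (S : sketching R n) (tau : R) (mmax : nat)
    (D : nat -> decomp R n) :
  stieltjes_density g ->
  no_breakdown A b D ->
  (adaptive_run (@perp_B R n) A b t S tau mmax D ->
     (matfuns_defined D ->
      forall D' : nat -> decomp R n,
        arnoldi_run A b D' -> same_lengths D D' -> same_approx g D D')
     /\
     (hermitian_posdef A ->
      converges_to (restart_approx g D) (matfun (stieltjes_fun g) A *m b)))
  /\
  (adaptive_run (perp_AB A) A b t S tau mmax D ->
     ((forall k, AB_gram A (D k) \in unitmx) ->
      matfuns_defined D ->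
      forall D' : nat -> decomp R n,
        harmonic_run A b D' -> same_lengths D D' -> same_approx g D D')
     /\
     (positive_real A ->
      converges_to (restart_approx g D) (matfun (stieltjes_fun g) A *m b))).
Proof.
move=> gS hb; split=> hr; split.
- by move=> hspec D' hr' hl; exact: (arnoldi_run_equivalent gS hb hr hspec hr' hl).
- exact: arnoldi_converges gS hb hr.
- by move=> hu hspec D' hr' hl; exact: (harmonic_run_equivalent gS hb hr hu hspec hr' hl).
- exact: harmonic_converges gS hb hr.
Qed.
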